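(* Let $H_1,\dots,H_n$ be hypotheses with (public) side information $\boldsymbol{x}_1,\dots,\boldsymbol{x}_n$ and $p$-values $p_1,\dots,p_n$, and let $\mathcal{H}_0\subseteq\{1,\dots,n\}$ be the set of indices of true null hypotheses. Assume that all the null $p$-values $(p_i)_{i\in\mathcal{H}_0}$ are independent of each other and of all the non-null $p$-values $(p_i)_{i\notin\mathcal{H}_0}$, and that the null $p$-values are mirror-conservative. Then the DP-AdaPT procedure with target level $\alpha$ (defined in the context) controls the false discovery rate at level $\alpha$: if $R$ is the number of hypotheses it rejects and $V$ is the number of rejected hypotheses with index in $\mathcal{H}_0$, then $$\mathrm{FDR}=\mathbb{E}\left[\frac{V}{\max\{R,1\}}\right]\le\alpha .$$
   Context: Mirror-conservative: a $[0,1]$-valued random variable $p$ is mirror-conservative if $\mathbb{P}(p\in[a_1,a_2])\le \mathbb{P}(p\in[1-a_2,1-a_1])$ for all $0\le a_1\le a_2\le 0.5$. Transformation $G$: let $U\in(0,\infty]$ and let $\nu$ be a measure on $\mathbb{R}$ (for instance Lebesgue measure, when the $p$-values have continuous distributions). Let $g\ge 0$ be a function with $g(x)=g(-x)$ for all $x$, $g(x)=0$ for $x\notin(-U,U)$, $\nu(\{x\in(-U,U):g(x)=0\})=0$ and $\int_{-\infty}^{\infty} g\,d\nu=1$. Let $G(x)=\int_{-\infty}^x g\,d\nu$, viewed as a strictly increasing cumulative distribution function, a one-to-one mapping from $(-U,U)$ to $[0,1]$, with quantile function $G^{-1}$. Sensitivity: each $p$-value $p_i=p_i(\mathcal{S})$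 is a deterministic function of a dataset $\mathcal{S}$ and has sensitivity at most $\Delta$, i.e. $|G^{-1}\{p_i(\mathcal{S})\}-G^{-1}\{p_i(\mathcal{S}')\}|\le\Delta$ for all pairs of datasets $\mathcal{S},\mathcal{S}'$ differing in exactly one record. Report Noisy Min with privacy parameter $\mu'$ applied to numbers $\{q_i\}_{i\in I}\subset[0,1]$: draw independent $Z_i\sim N(0,8\Delta^2/\mu'^2)$, $i\in I$, and return the index $\arg\min_{i\in I} G[G^{-1}(q_i)+Z_i]$ (the algorithm also returns a freshly noised value for that index, which is not used below). Mirror Peeling with privacy parameter $\mu$ and size $m\le n$: start with $I=\{1,\dots,n\}$. For $j=1,\dots,m$: let $i_j$ be the index returned by Report Noisy Min applied to $\{\min(p_i,1-p_i)\}_{i\in I}$ with privacy parameter $\mu/\sqrt m$; set $\tilde p_{i_j}=G[G^{-1}(p_{i_j})+Z]$ with a fresh independent $Z\sim N(0,8m\Delta^2/\mu^2)$; replace $I$ by $I\setminus\{i_j\}$. Return $(i_1,\tilde p_{i_1}),\dots,(i_m,\tilde p_{i_m})$. The noise variables are independent of each other and of the data. DP-AdaPT with target FDR level $\alpha$: run Mirror Peeling to get $(i_j,\tilde p_{i_j})_{j=1}^m$. Start from an initial threshold function $s_0(\cdot)$ of the side information. For $t=0,1,2,\dots$: let $R_t=|\{j:\tilde p_{i_j}\le s_t(\boldsymbol{x}_{i_j})\}|$, $A_t=|\{j:\tilde p_{i_j}\ge 1-s_t(\boldsymbol{x}_{i_j})\}|$ and $\widehat{\mathrm{FDR}}=(1+A_t)/\max(R_t,1)$.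 If $\widehat{\mathrm{FDR}}\le\alpha$, reject $\{H_{i_j}:\tilde p_{i_j}\le s_t(\boldsymbol{x}_{i_j})\}$ and stop. Otherwise, compute a new threshold function $s_{t+1}$ by any update rule from $(\boldsymbol{x}_{i_j},\tilde p_{pm,t,i_j})_{j=1}^m$, $A_t$, $R_t$, $s_t$, where the partially masked value $\tilde p_{pm,t,i_j}$ equals $\tilde p_{i_j}$ if $s_t(\boldsymbol{x}_{i_j})<\tilde p_{i_j}<1-s_t(\boldsymbol{x}_{i_j})$, and equals the unordered pair $\{\tilde p_{i_j},1-\tilde p_{i_j}\}$ otherwise. The update must satisfy two principles: $s_{t+1}(\boldsymbol{x})\le s_t(\boldsymbol{x})$ for every $\boldsymbol{x}$, and $s_{t+1}$ is measurable with respect to $\mathcal{F}_t=\sigma\big(\{\boldsymbol{x}_{i_j},\tilde p_{pm,t,i_j}\}_{j=1}^m,A_t,R_t\big)$, the information available to the analyst at step $t$.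
   Formalization: Two assumptions are added, since the claim fails without them: the measure ν is symmetric, ν(-B)=ν(B) (automatic for Lebesgue measure), and the initial threshold satisfies s_0(x) ≤ 1/2 for every x. *)

(* Defs.v *)
From HB Require Import structures.
From mathcomp Require Import all_boot all_order all_algebra.
From mathcomp Require Import all_classical all_reals all_analysis.

Set Implicit Arguments.
Unset Strict Implicit.
Unset Printing Implicit Defensive.

Import Order.TTheory GRing.Theory Num.Theory.
Import numFieldNormedType.Exports.

Local Open Scope classical_set_scope.
Local Open Scope ring_scope.

Definition sigma_of {d d'} {T : measurableType d} {T' : measurableType d'}
    (Y : T -> T') : set (set T) :=
  preimage_set_system setT Y measurable.

Definition sigma_family {d d'} {T : measurableType d} {T' : measurableType d'}
    {I : finType} (A : {set I}) (Y : I -> T -> T') : set (set T) :=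
  <<s \bigcup_(i in [set` A]) sigma_of (Y i) >>.

Definition independent {d} {T : measurableType d} {R : realType}
    (P : probability T R) (F1 F2 : set (set T)) : Prop :=
  forall E1 E2, F1 E1 -> F2 E2 -> P (E1 `&` E2) = (P E1 * P E2)%E.

Definition mutually_independent {d} {T : measurableType d} {R : realType}
    (P : probability T R) {I : finType} (A : {set I})
    (F : I -> set (set T)) : Prop :=
  forall (B : {set I}) (E : I -> set T),
    B \subset A -> (forall i, i \in B -> F i (E i)) ->
    P (\bigcap_(i in [set` B]) E i) = (\prod_(i in B) P (E i))%E.

Definition mirror_conservative {d} {T : measurableType d} {R : realType}
    (P : probability T R) (p : T -> R) : Prop :=
  forall a1 a2 : R, 0 <= a1 -> a1 <= a2 -> a2 <= 2^-1 ->
    (P [set om | (a1 <= p om <= a2)%R] <=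
     P [set om | (1 - a2 <= p om <= 1 - a1)%R])%E.

Section Transformation.
Context {R : realType}.
Variables (nu : {measure set (measurableTypeR R) -> \bar R}).
Variables (U : \bar R) (g : R -> R).

(* G on the extended line, so that G(-oo) = 0 and G(+oo) = 1. *)
Definition G (x : \bar R) : R :=
  fine (\int[nu]_(t in [set t : R | (t%:E <= x)%E]) (g t)%:E)%E.

(* The infimum is over [-U, U], so G^{-1}(0) = -U and G^{-1}(1) = U (which are
   infinite when U = +oo); over the whole extended line, G^{-1}(0) would be -oo
   even for finite U, and G^{-1}(1 - q) = - G^{-1}(q) would fail at q = 1. *)
Definition Ginv (q : R) : \bar R :=
  ereal_inf [set x : \bar R | (- U <= x <= U)%E /\ q <= G x].

(* [symmetric_base] is automatic for Lebesgue measure; without it, g(-x) = g(x)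
   does not make the distribution g dnu symmetric. *)
Record transformation : Prop := {
  U_gt0 : (0 < U)%E;
  symmetric_base : forall B : set (measurableTypeR R), measurable B ->
    nu [set x | B (- x)] = nu B;
  g_measurable :
    measurable_fun [set: measurableTypeR R] (g : measurableTypeR R -> R);
  g_ge0 : forall x, 0 <= g x;
  g_even : forall x, g (- x) = g x;
  g_support : forall x, ~~ (- U < x%:E < U)%E -> g x = 0;
  g_ae_pos : nu [set x | (- U < x%:E < U)%E /\ g x = 0] = 0%E;
  g_mass : (\int[nu]_x (g x)%:E = 1)%E;
  G_increasing : forall x y : R,
    (- U < x%:E)%E -> x < y -> (y%:E < U)%E -> G x%:E < G y%:E
}.

Definition add_noise (q z : R) : R := G (Ginv q + z%:E)%E.

End Transformation.

Definition adjacent {X : Type} {N : nat} (D D' : N.-tuple X) : Prop :=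
  exists k, tnth D k <> tnth D' k /\
    forall l, l != k -> tnth D l = tnth D' l.

(* |G^{-1}(p(D)) - G^{-1}(p(D'))| <= Delta, written without a difference since
   both quantiles may be the same infinity; adjacency is symmetric. *)
Definition sensitivity_at_most {R : realType}
    (nu : {measure set (measurableTypeR R) -> \bar R}) (U : \bar R) (g : R -> R)
    {X : Type} {N : nat} (p : N.-tuple X -> R) (Delta : R) : Prop :=
  forall D D', adjacent D D' ->
    (Ginv nu U g (p D) <= Ginv nu U g (p D') + Delta%:E)%E.

Definition tie_breaking {I : finType} (tie : {set I} -> I) : Prop :=
  forall A : {set I}, A != finset.set0 -> tie A \in A.

Section Peeling.
Context {R : realType}.
Variables (nu : {measure set (measurableTypeR R) -> \bar R}).
Variables (U : \bar R) (g : R -> R).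
Variables (n : nat) (tie : {set 'I_n} -> 'I_n).

Definition report_noisy_min (I : {set 'I_n}) (q z : 'I_n -> R) : 'I_n :=
  let noisy i := add_noise nu U g (q i) (z i) in
  tie [set i in I | [forall k in I, noisy i <= noisy k]]%SET.

Variables (p : 'I_n -> R) (z : nat -> 'I_n -> R) (w : nat -> R).

Definition mirrored (i : 'I_n) : R := Num.min (p i) (1 - p i).

Fixpoint remaining (j : nat) : {set 'I_n} :=
  if j is j'.+1
  then (remaining j' :\ report_noisy_min (remaining j') mirrored (z j'))%SET
  else [set: 'I_n]%SET.

Definition selected (j : nat) : 'I_n :=
  report_noisy_min (remaining j) mirrored (z j).

Definition released (j : nat) : R := add_noise nu U g (p (selected j)) (w j).

End Peeling.

Section AdaPT.
Context {R : realType} {X : Type}.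

(* What the analyst sees: for each j, x_{i_j} and the partially masked value;
   then A_t and R_t. A masked value (true, v) stands for the unordered pair
   {v, 1 - v}, represented by its smaller element; (false, v) is the unmasked
   value v. *)
Definition observation (m : nat) : Type :=
  (m.-tuple (X * (bool * R)) * (nat * nat))%type.

Variables (n m : nat) (x : 'I_n -> X).
Variables (idx : nat -> 'I_n) (pt : nat -> R).

Definition num_rejections (s : X -> R) : nat :=
  #|[set j : 'I_m | pt j <= s (x (idx j))]%SET|.

Definition num_mirror (s : X -> R) : nat :=
  #|[set j : 'I_m | 1 - s (x (idx j)) <= pt j]%SET|.

Definition partially_masked (s : X -> R) (j : nat) : bool * R :=
  if s (x (idx j)) < pt j < 1 - s (x (idx j)) then (false, pt j)
  else (true, Num.min (pt j) (1 - pt j)).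

Definition observed (s : X -> R) : observation m :=
  ([tuple (x (idx j), partially_masked s j) | j < m],
   (num_mirror s, num_rejections s)).

Variables (s0 : X -> R) (update : nat -> observation m -> (X -> R) -> X -> R).

Fixpoint threshold (t : nat) : X -> R :=
  if t is t'.+1
  then update t' (observed (threshold t')) (threshold t')
  else s0.

Definition fdr_hat (t : nat) : R :=
  (1 + num_mirror (threshold t))%:R / (maxn (num_rejections (threshold t)) 1)%:R.

(* No rejection if the estimate never falls below the target level. *)
Definition rejected (alpha : R) : {set 'I_n} :=
  match pselect (exists t, fdr_hat t <= alpha) with
  | left stops =>
      [set idx j | j : 'I_m &
         (pt j <= threshold (ex_minn stops) (x (idx j)))%R]%SET
  | right _ => finset.set0
  end.

End AdaPT.

Definition fdp {R : realType} {n : nat} (H0 rej : {set 'I_n}) : R :=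
  #|(rej :&: H0)%SET|%:R / (maxn #|rej| 1)%:R.

Definition rnm_sd {R : realType} (Delta mu : R) : R :=
  Num.sqrt (8 * Delta ^+ 2 / mu ^+ 2).

Definition release_sd {R : realType} (m : nat) (Delta mu : R) : R :=
  Num.sqrt (8 * m%:R * Delta ^+ 2 / mu ^+ 2).

(* The noise variables of the m rounds of peeling: inl (j, i) perturbs
   hypothesis i in the selection of round j, and inr j perturbs the p-value
   released in round j. *)
Definition noise {T : Type} {R : realType} {m n : nat}
    (Z : nat -> 'I_n -> T -> R) (W : nat -> T -> R)
    (k : ('I_m * 'I_n) + 'I_m) : T -> R :=
  match k with
  | inl ji => Z ji.1 ji.2
  | inr j => W j
  end.

Record peeling_noise {d dD} {T : measurableType d} {Data : measurableType dD}
    {R : realType} (P : probability T R) (S : T -> Data) (n m : nat)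
    (Delta mu : R) (Z : nat -> 'I_n -> {RV P >-> R}) (W : nat -> {RV P >-> R})
    : Prop := {
  Z_normal : forall (j : 'I_m) (i : 'I_n),
    forall B, measurable B ->
    distribution P (Z j i) B = normal_prob 0 (rnm_sd Delta (mu / Num.sqrt m%:R)) B;
  W_normal : forall j : 'I_m,
    forall B, measurable B ->
    distribution P (W j) B = normal_prob 0 (release_sd m Delta mu) B;
  noise_independent : mutually_independent P
    [set: ('I_m * 'I_n) + 'I_m]%SET (fun k => sigma_of (noise Z W k));
  noise_data_independent : independent P
    (sigma_of S)
    (sigma_family [set: ('I_m * 'I_n) + 'I_m]%SET (noise Z W))
}.

Section DPAdaPT.
Context {R : realType} {dX d : measure_display}.
Context {X : measurableType dX} {T : measurableType d}.
Variables (nu : {measure set (measurableTypeR R) -> \bar R}).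
Variables (U : \bar R) (g : R -> R).
Variables (n m : nat) (tie : {set 'I_n} -> 'I_n) (x : 'I_n -> X).
Variables (p : 'I_n -> T -> R) (Z : nat -> 'I_n -> T -> R) (W : nat -> T -> R).
Variables (s0 : X -> R)
  (update : nat -> @observation R X m -> (X -> R) -> X -> R).

Definition dp_index (om : T) : nat -> 'I_n :=
  selected nu U g tie (p ^~ om) (fun j i => Z j i om).

Definition dp_pvalue (om : T) : nat -> R :=
  released nu U g tie (p ^~ om) (fun j i => Z j i om) (W ^~ om).

Definition dp_threshold (t : nat) (om : T) : X -> R :=
  threshold x (dp_index om) (dp_pvalue om) s0 update t.

Definition dp_observed (t : nat) (om : T) : observation m :=
  observed m x (dp_index om) (dp_pvalue om) (dp_threshold t om).

(* F_t is the sigma-algebra generated by the observation at step t. *)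
Record update_principles : Prop := {
  threshold_nonincreasing : forall t om y,
    dp_threshold t.+1 om y <= dp_threshold t om y;
  threshold_adapted : forall t y (B : set R), measurable B ->
    sigma_of (dp_observed t) [set om | B (dp_threshold t.+1 om y)]
}.

Definition dp_adapt (alpha : R) (om : T) : {set 'I_n} :=
  rejected x (dp_index om) (dp_pvalue om) s0 update alpha.

End DPAdaPT.

(* Main.v *)
(* The proof is a leave-one-out argument rather than a martingale one.

   Folding: for a round j that selects a null hypothesis, replace the released
   value by min(pt_j, 1 - pt_j), rerun AdaPT up to its stopping time with final
   threshold s^j, and put
     w_j = 1{fold_j <= s^j} / (1 + #{null k <> j : pt_k >= 1 - s^j}),
   a function of the folded value. If j is rejected then pt_j is already folded
   and the rerun is the actual run, so FDP <= alpha sum_j 1{pt_j <= 1/2} w_j.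
   Conversely, if pt_j, pt_k > 1/2 and w_j, w_k <> 0, the reruns for j and k see
   the same masked data and the same A_t and R_t at each step, hence end with the
   same threshold; therefore sum_j 1{pt_j > 1/2} w_j <= 1.

   Mirroring: it remains to show E[1{pt_j <= 1/2} w_j] <= E[1{pt_j > 1/2} w_j].
   Given the identity i of the null selected in round j, freeze everything but
   p_i and the noise W_j. The selection depends on p_i only through
   min(p_i, 1 - p_i). Replacing (p_i, W_j) by (1 - p_i, - W_j) replaces pt_j by
   1 - pt_j outside of a null set, W_j is symmetric, and for p_i >= 1/2 the noisy
   quantile has a nonnegative center c, where the density of N(c, s^2) dominates
   that of N(-c, s^2) on the right half-line. With the mirror-conservativeness of
   p_i this gives the inequality. *)
Require Import Defs.
From HB Require Import structures.
From mathcomp Require Import all_boot all_order all_algebra.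
From mathcomp Require Import all_classical all_reals all_analysis.
From mathcomp Require Import measurable_realfun perm ring lra.

Set Implicit Arguments.
Unset Strict Implicit.
Unset Printing Implicit Defensive.

Import Order.TTheory GRing.Theory Num.Theory.
Import numFieldNormedType.Exports.

Local Open Scope classical_set_scope.
Local Open Scope ring_scope.

(** * The leave-one-out bound on the false discovery proportion *)

(** The hypothesis selected in round [j] is random, so its p-value cannot be frozen as it stands.
    The expectation is split over the finitely many injective assignments [sg] of hypotheses to
    rounds; on each piece, round [j] concerns the fixed p-value of [sg j]. The weight then still
    depends on this p-value, through the selection, which is why the reflection acts on p-value and
    release noise jointly.

    Three mismatches with the hypotheses shape the rest. The base measure [nu] may have atoms, so
    [G (- y) = 1 - G y] can fail; it fails only at countably many [y], which nondegenerate Gaussian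
    noise almost surely avoids. Mirror-conservativeness speaks of closed intervals, while the
    weights require arbitrary Borel sets; the extension goes through outer approximation by
    intervals. Finally, the update principles constrain [update] only along runs that some outcome
    realizes, whereas the leave-one-out reruns feed it folded data; [update] is therefore replaced
    by a measurable nonincreasing rule that agrees with it on actual runs. *)

Section leave_one_out.
Context {R : realType} {X : Type}.
Variables (n m : nat) (x : 'I_n -> X) (s0 : X -> R)
  (update : nat -> @observation R X m -> (X -> R) -> X -> R) (alpha : R).

(** [idx] and [pt] are functions on all of [nat], but only rounds below [m] are ever read; this and
    the next congruences make values beyond [m] irrelevant. *)
Lemma observed_congr (idx idx' : nat -> 'I_n) (pt pt' : nat -> R) (s : X -> R) :
  (forall k : 'I_m, idx k = idx' k) -> (forall k : 'I_m, pt k = pt' k) ->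
  observed m x idx pt s = observed m x idx' pt' s.
Proof.
move=> eidx ept; rewrite /observed; congr (_, (_, _)).
- by apply: eq_from_tnth => k; rewrite !tnth_mktuple /partially_masked eidx ept.
- by apply: eq_card => k; rewrite !inE eidx ept.
- by apply: eq_card => k; rewrite !inE eidx ept.
Qed.

Lemma threshold_congr (idx idx' : nat -> 'I_n) (pt pt' : nat -> R) t :
  (forall k : 'I_m, idx k = idx' k) -> (forall k : 'I_m, pt k = pt' k) ->
  threshold x idx pt s0 update t = threshold x idx' pt' s0 update t.
Proof.
move=> eidx ept; elim: t => //= t ->.
by rewrite (observed_congr _ eidx ept).
Qed.

Lemma fdr_hat_congr (idx idx' : nat -> 'I_n) (pt pt' : nat -> R) t :
  (forall k : 'I_m, idx k = idx' k) -> (forall k : 'I_m, pt k = pt' k) ->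
  fdr_hat x idx pt s0 update t = fdr_hat x idx' pt' s0 update t.
Proof.
move=> eidx ept; rewrite /fdr_hat (threshold_congr t eidx ept).
have := observed_congr (threshold x idx' pt' s0 update t) eidx ept.
by move=> /(congr1 snd) /= [-> ->].
Qed.

(** The stopping time as a decidable relation between a run and a time: runs can be compared, and
    the event of stopping at a given time measured, with no witness that the run stops. *)
Definition stops_first (idx : nat -> 'I_n) (q : nat -> R) (t : nat) : bool :=
  (fdr_hat x idx q s0 update t <= alpha) &&
  [forall t' : 'I_t, ~~ (fdr_hat x idx q s0 update t' <= alpha)].

Lemma stops_first_inj idx q t t' :
  stops_first idx q t -> stops_first idx q t' -> t = t'.
Proof.
move=> /andP[h1 /forallP f1] /andP[h2 /forallP f2].
case: (ltngtP t t') => // lt.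
- by have := f2 (Ordinal lt); rewrite h1.
- by have := f1 (Ordinal lt); rewrite h2.
Qed.

Lemma stops_first_ex_minn idx q
    (ex : exists t, fdr_hat x idx q s0 update t <= alpha) :
  stops_first idx q (ex_minn ex).
Proof.
case: ex_minnP => t ht tmin; rewrite /stops_first ht /=.
apply/forallP => t'; apply/negP => /tmin.
by rewrite leqNgt ltn_ord.
Qed.

(* To be applied to [q := fold_at j pt], so that the weight of round [j] does
   not depend on which of [pt j] and [1 - pt j] was released. *)
Definition loo_weight_at (idx : nat -> 'I_n) (J : {set 'I_m}) (j : 'I_m)
    (q : nat -> R) (t : nat) : R :=
  let s := threshold x idx q s0 update t in
  if q j <= s (x (idx j))
  then (1 + #|[set k in J | (k != j) && (1 - s (x (idx k)) <= q k)]%SET|)%:R^-1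
  else 0.

Definition loo_weight (idx : nat -> 'I_n) (J : {set 'I_m}) (j : 'I_m)
    (q : nat -> R) : R :=
  match pselect (exists t, fdr_hat x idx q s0 update t <= alpha) with
  | left ex => loo_weight_at idx J j q (ex_minn ex)
  | right _ => 0
  end.

Lemma loo_weight_stops idx J j q t :
  stops_first idx q t -> loo_weight idx J j q = loo_weight_at idx J j q t.
Proof.
move=> st; rewrite /loo_weight; case: pselect => [ex|[]]; last first.
  by case/andP: st; exists t.
by rewrite (stops_first_inj st (stops_first_ex_minn ex)).
Qed.

Lemma loo_weight_never idx J j q :
  (forall t, ~~ stops_first idx q t) -> loo_weight idx J j q = 0.
Proof.
move=> ns; rewrite /loo_weight; case: pselect => // ex.
by have := ns (ex_minn ex); rewrite stops_first_ex_minn.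
Qed.

Lemma loo_weight_congr (idx idx' : nat -> 'I_n) J j (q q' : nat -> R) :
  (forall k : 'I_m, idx k = idx' k) -> (forall k : 'I_m, q k = q' k) ->
  loo_weight idx J j q = loo_weight idx' J j q'.
Proof.
move=> eidx eq.
have est t : stops_first idx q t = stops_first idx' q' t.
  rewrite /stops_first (fdr_hat_congr _ eidx eq); congr (_ && _).
  by apply: eq_forallb => t'; rewrite (fdr_hat_congr _ eidx eq).
have [[t st]|ns] := pselect (exists t, stops_first idx q t).
  rewrite (loo_weight_stops _ _ st) (@loo_weight_stops _ _ _ _ t) -?est //.
  rewrite /loo_weight_at (threshold_congr _ eidx eq) eq eidx.
  case: ifP => // _; congr (_%:R^-1); congr addn.
  by apply: eq_card => k; rewrite !inE eq eidx.
by rewrite !loo_weight_never // => t; [rewrite -est|]; apply/negP => st;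
  apply: ns; exists t.
Qed.

Lemma loo_weight_ge0 idx J j q : 0 <= loo_weight idx J j q.
Proof.
rewrite /loo_weight; case: pselect => // ex.
by rewrite /loo_weight_at; case: ifP => // _; rewrite invr_ge0.
Qed.

Lemma loo_weight_le1 idx J j q : loo_weight idx J j q <= 1.
Proof.
rewrite /loo_weight; case: pselect => // ex.
rewrite /loo_weight_at; case: ifP => // _.
by rewrite invf_le1 ?ltr0n ?addn_gt0 // ler1n.
Qed.

Definition fold_at (j : 'I_m) (pt : nat -> R) (k : nat) : R :=
  if k == j then Num.min (pt j) (1 - pt j) else pt k.

Hypothesis s0_half : forall y, s0 y <= 2^-1.
Hypothesis update_le : forall t o s y, update t o s y <= s y.
Variables (idx : nat -> 'I_n).

Lemma threshold_le q t t' y : (t <= t')%N ->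
  threshold x idx q s0 update t' y <= threshold x idx q s0 update t y.
Proof.
elim: t' => [|t' IH]; first by rewrite leqn0 => /eqP ->.
rewrite leq_eqVlt => /orP[/eqP -> //|]; rewrite ltnS => /IH.
by apply: le_trans; exact: update_le.
Qed.

Lemma threshold_le_half q t y : threshold x idx q s0 update t y <= 2^-1.
Proof. exact: le_trans (threshold_le q y (leq0n t)) (s0_half y). Qed.

Hypothesis idx_inj : injective (fun j : 'I_m => idx j).
Variables (H0 : {set 'I_n}) (pt : nat -> R).
Let J := [set j : 'I_m | idx j \in H0]%SET.

(** When the run stops, [1 + A_t <= alpha * max(R_t, 1)], so each rejected null costs at most
    [alpha / (1 + A_t)]. The denominator of the weight counts only the null mirror values other than
    [j], hence is at most [1 + A_t]. *)
Lemma fdp_le_loo_weight : 0 <= alpha ->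
  fdp H0 (rejected x idx pt s0 update alpha) <=
  alpha * \sum_(j in J) (pt j <= 2^-1)%R%:R * loo_weight idx J j (fold_at j pt).
Proof.
move=> alpha0.
have rhs0 : 0 <= alpha *
    \sum_(j in J) (pt j <= 2^-1)%R%:R * loo_weight idx J j (fold_at j pt).
  by rewrite mulr_ge0 // sumr_ge0 // => j _; rewrite mulr_ge0 // loo_weight_ge0.
rewrite /rejected; case: pselect => [ex|_]; last first.
  by rewrite /fdp finset.set0I cards0 mul0r.
move: (ex_minn ex) (stops_first_ex_minn ex) => t st.
set s := threshold _ _ _ _ _ t.
pose Rt := [set j : 'I_m | pt j <= s (x (idx j))]%SET.
pose f (j : 'I_m) := idx j.
have -> : [set idx j | j : 'I_m & pt j <= s (x (idx j))]%SET = (f @: Rt)%SET.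
  by apply/setP => i; apply/imsetP/imsetP => -[j];
    rewrite !inE => jr ->; exists j; rewrite ?inE.
rewrite /fdp; have -> : (f @: Rt :&: H0)%SET = (f @: (Rt :&: J))%SET.
  apply/setP => i; rewrite inE; apply/andP/imsetP.
    by move=> [/imsetP[j jR ->] iH]; exists j; rewrite // inE jR inE.
  move=> [j]; rewrite inE => /andP[jR]; rewrite inE => jH ->; split => //.
  by apply/imsetP; exists j.
rewrite !card_imset //.
have hR : #|Rt| = num_rejections m x idx pt s by [].
case/andP: (st) => + _; rewrite /fdr_hat -/s hR => hstop.
set A := num_mirror _ _ _ _ _ in hstop *.
set M := maxn _ _ in hstop *.
have M0 : 0 < M%:R :> R by rewrite ltr0n leq_max orbT.
have A0 : 0 < (1 + A)%:R :> R by rewrite ltr0n.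
have le1 : #|(Rt :&: J)%SET|%:R / M%:R <= alpha * (#|(Rt :&: J)%SET|%:R / (1 + A)%:R).
  have -> : #|(Rt :&: J)%SET|%:R / M%:R =
      ((1 + A)%:R / M%:R) * (#|(Rt :&: J)%SET|%:R / (1 + A)%:R) :> R.
    by field; rewrite !gt_eqF.
  by rewrite ler_wpM2r // divr_ge0.
apply: le_trans le1 _; apply: ler_wpM2l => //.
rewrite mulr_natl -sumr_const.
rewrite [leRHS](bigID (fun j => j \in Rt)) /= -[leLHS]addr0 lerD //; last first.
  by rewrite sumr_ge0 // => j _; rewrite mulr_ge0 // loo_weight_ge0.
rewrite (eq_bigl (fun j => (j \in J) && (j \in Rt))); last first.
  by move=> j; rewrite inE andbC.
apply: ler_sum => j /andP[jJ]; rewrite inE => jR.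
have pth : pt j <= 2^-1 by apply: le_trans jR _; exact: threshold_le_half.
have eqf (k : 'I_m) : fold_at j pt k = pt k.
  rewrite /fold_at; case: eqP => // ->; rewrite min_l //; lra.
rewrite pth mul1r (loo_weight_congr J j (fun=> erefl) eqf).
rewrite (loo_weight_stops _ _ st) /loo_weight_at -/s jR.
rewrite lef_pV2 ?posrE ?ltr0n ?addn_gt0 // ler_nat leq_add2l.
apply: subset_leq_card; apply/fintype.subsetP => k; rewrite !inE.
by case/and3P.
Qed.

(* Folding [j] rather than [k] trades one mirror value for one rejection in
   either run, so A_t and R_t coincide. Strictness matters: at the common value
   1/2 = s_t a round would count both as a rejection and as a mirror value. *)
Lemma fold_runs_agree (j k : 'I_m) t : j != k ->
  2^-1 < pt j -> 2^-1 < pt k ->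
  fold_at j pt j <= threshold x idx (fold_at j pt) s0 update t (x (idx j)) ->
  fold_at k pt k <= threshold x idx (fold_at k pt) s0 update t (x (idx k)) ->
  threshold x idx (fold_at j pt) s0 update t =
  threshold x idx (fold_at k pt) s0 update t ->
  observed m x idx (fold_at j pt) (threshold x idx (fold_at j pt) s0 update t) =
  observed m x idx (fold_at k pt) (threshold x idx (fold_at k pt) s0 update t).
Proof.
move=> jk hj hk + + es; rewrite -es; set s := threshold _ _ _ _ _ t.
have sh y : s y <= 2^-1 by exact: threshold_le_half.
have nkj : ((k : nat) == j) = false by apply: negbTE; rewrite eq_sym.
have njk : ((j : nat) == k) = false by apply: negbTE.
have fj : fold_at j pt j = 1 - pt j by rewrite /fold_at eqxx min_r //; lra.
have fk : fold_at k pt k = 1 - pt k by rewrite /fold_at eqxx min_r //; lra.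
have fjk : fold_at j pt k = pt k by rewrite /fold_at nkj.
have fkj : fold_at k pt j = pt j by rewrite /fold_at njk.
have fo (l : 'I_m) : l != j -> l != k -> fold_at j pt l = fold_at k pt l.
  move=> lj lk; rewrite /fold_at.
  by rewrite (negbTE (lj : (l : nat) != j)) (negbTE (lk : (l : nat) != k)).
rewrite fj fk => sj sk; have := sh (x (idx j)); have := sh (x (idx k)).
move=> shk shj; rewrite /observed; congr (_, (_, _)).
(* Both [j] and [k] are masked in either run, and masking forgets which element of the pair was
   released. *)
- apply: eq_from_tnth => l; rewrite !tnth_mktuple; congr pair.
  rewrite /partially_masked.
  have [->|lj] := eqVneq l j.
    rewrite fj fkj !ifF; try by apply/negbTE; rewrite negb_and -!leNgt; apply/orP; lra.
    congr pair; rewrite min_l ?min_r //; lra.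
  have [->|lk] := eqVneq l k.
    rewrite fk fjk !ifF; try by apply/negbTE; rewrite negb_and -!leNgt; apply/orP; lra.
    congr pair; rewrite min_r ?min_l //; lra.
  by rewrite fo.
(* In run [j], round [j] is a rejection and round [k] a mirror value; in run [k] the roles are
   exchanged. The transposition of [j] and [k] thus maps the counted set of one run onto that of the
   other, here and for the rejections. *)
- rewrite /num_mirror -(card_imset _ (@perm_inj _ (tperm j k))).
  apply: eq_card => l; rewrite -{1}(tpermK j k l) mem_imset ?inE; last exact: perm_inj.
  case: tpermP => [->|->|/eqP lj /eqP lk]; rewrite ?fj ?fk ?fjk ?fkj ?fo //;
    apply/idP/idP; lra.
- rewrite /num_rejections -(card_imset _ (@perm_inj _ (tperm j k))).
  apply: eq_card => l; rewrite -{1}(tpermK j k l) mem_imset ?inE; last exact: perm_inj.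
  case: tpermP => [->|->|/eqP lj /eqP lk]; rewrite ?fj ?fk ?fjk ?fkj ?fo //;
    apply/idP/idP; lra.
Qed.

(** Thresholds decrease, so a folded value below the final threshold is below all earlier ones and
    [fold_runs_agree] applies by induction up to the smaller of the two stopping times. There the
    estimates coincide, so the run that stops first makes the other stop as well. *)
Lemma fold_runs_stop_together (j k : 'I_m) tj tk : j != k ->
  2^-1 < pt j -> 2^-1 < pt k ->
  stops_first idx (fold_at j pt) tj -> stops_first idx (fold_at k pt) tk ->
  fold_at j pt j <= threshold x idx (fold_at j pt) s0 update tj (x (idx j)) ->
  fold_at k pt k <= threshold x idx (fold_at k pt) s0 update tk (x (idx k)) ->
  tj = tk /\ threshold x idx (fold_at j pt) s0 update tj =
             threshold x idx (fold_at k pt) s0 update tk.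
Proof.
move=> jk hj hk stj stk mj mk.
have agree t : (t <= tj)%N -> (t <= tk)%N ->
    threshold x idx (fold_at j pt) s0 update t =
    threshold x idx (fold_at k pt) s0 update t /\
    observed m x idx (fold_at j pt) (threshold x idx (fold_at j pt) s0 update t) =
    observed m x idx (fold_at k pt) (threshold x idx (fold_at k pt) s0 update t).
  elim: t => [|t IH] t1 t2.
    split => //; apply: fold_runs_agree => //.
    - exact: le_trans mj (threshold_le _ _ t1).
    - exact: le_trans mk (threshold_le _ _ t2).
  have [e1 e2] := IH (ltnW t1) (ltnW t2).
  have e3 : threshold x idx (fold_at j pt) s0 update t.+1 =
      threshold x idx (fold_at k pt) s0 update t.+1 by rewrite /= e1 -e2 e1.
  split => //; apply: fold_runs_agree => //.
  - exact: le_trans mj (threshold_le _ _ t1).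
  - exact: le_trans mk (threshold_le _ _ t2).
have fdrE t : (t <= tj)%N -> (t <= tk)%N ->
    fdr_hat x idx (fold_at j pt) s0 update t =
    fdr_hat x idx (fold_at k pt) s0 update t.
  move=> t1 t2; have [_ /(congr1 snd) /= [e1 e2]] := agree t t1 t2.
  by rewrite /fdr_hat e1 e2.
suff e : tj = tk by split => //; rewrite -e; apply: (agree tj _ _).1; rewrite ?e.
case/andP: stj => hsj /forallP nsj; case/andP: stk => hsk /forallP nsk.
case: (ltngtP tj tk) => // lt.
- by have := nsk (Ordinal lt); rewrite /= -fdrE ?hsj // ltnW.
- by have := nsj (Ordinal lt); rewrite /= fdrE ?hsk // ltnW.
Qed.

(** Let [B] be the set of rounds that contribute. They share one final threshold, and each of them
    other than [j] is a null mirror value in run [j]. The denominator of every contributing weight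
    is therefore at least [#|B|], and [#|B|] terms of size at most [1 / #|B|] are summed. *)
Lemma sum_loo_weight_le1 :
  \sum_(j in J) (2^-1 < pt j)%R%:R * loo_weight idx J j (fold_at j pt) <= 1.
Proof.
pose act (j : 'I_m) := [&& j \in J, 2^-1 < pt j &
  loo_weight idx J j (fold_at j pt) != 0].
have actE j : act j -> exists t, [/\ stops_first idx (fold_at j pt) t,
    fold_at j pt j <= threshold x idx (fold_at j pt) s0 update t (x (idx j)) &
    loo_weight idx J j (fold_at j pt) = loo_weight_at idx J j (fold_at j pt) t].
  case/and3P => jJ hj wn.
  have [[t st]|ns] := pselect (exists t, stops_first idx (fold_at j pt) t).
    exists t; split => //; last exact: loo_weight_stops.
    by move: wn; rewrite (loo_weight_stops _ _ st) /loo_weight_at; case: ifP => //;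
      rewrite eqxx.
  by move: wn; rewrite loo_weight_never ?eqxx // => t; apply/negP => st; apply: ns; exists t.
pose B := [set j | act j]%SET.
have wB j : act j -> loo_weight idx J j (fold_at j pt) <= #|B|%:R^-1.
  move=> aj; have [t [st mj ->]] := actE j aj.
  rewrite /loo_weight_at mj lef_pV2 ?posrE ?ltr0n ?addn_gt0 //; last first.
    by apply/card_gt0P; exists j; rewrite inE.
  rewrite ler_nat (cardsD1 j) inE aj /= leq_add2l; apply: subset_leq_card.
  apply/fintype.subsetP => k; rewrite !inE => /andP[kj ak].
  have [t' [st' mk _]] := actE k ak.
  case/and3P: (aj) => _ hj _; case/and3P: (ak) => kJ hk _.
  rewrite inE in kJ; rewrite kJ kj /=.
  have jk : j != k by rewrite eq_sym.
  have [_ ->] := fold_runs_stop_together jk hj hk st st' mj mk.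
  (* For [k] folded, lying below the threshold means [1 - pt k <= s], which is the mirror condition
     for [pt k] in run [j]. *)
  move: mk; rewrite {1}/fold_at eqxx min_r; last by lra.
  rewrite /fold_at ifF; last exact: negbTE.
  lra.
have [B0|Bpos] := posnP #|B|.
  rewrite big1 ?ler01 // => j jJ; have [hj|] := boolP (2^-1 < pt j); last by rewrite mul0r.
  have [->|wn] := eqVneq (loo_weight idx J j (fold_at j pt)) 0; first by rewrite mulr0.
  have : j \in B by rewrite inE /act jJ hj wn.
  by move/card0_eq: B0 => ->.
apply: (@le_trans _ _ (\sum_(j in B) #|B|%:R^-1)); last first.
  by rewrite sumr_const -[leLHS]mulr_natl divff // pnatr_eq0 -lt0n.
rewrite (bigID (mem B)) /= [X in _ + X]big1 ?addr0; last first.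
  move=> j /andP[jJ]; rewrite inE /act jJ /=.
  case: ltP; rewrite ?mul0r //= => _.
  by rewrite negbK => /eqP ->; rewrite mulr0.
rewrite (eq_bigl (mem B)); last first.
  by move=> j /=; rewrite andbC; apply/andP/idP => [[]//|jB]; split => //;
    move: jB; rewrite inE => /and3P[].
apply: ler_sum => j jB; have aj : act j by move: jB; rewrite !inE.
by case/and3P: (aj) => _ -> _; rewrite mul1r wB.
Qed.

End leave_one_out.

(** * Symmetry of the transformation *)

Section transformation_facts.
Context {R : realType}.
Variables (nu : {measure set (measurableTypeR R) -> \bar R}) (U : \bar R)
  (g : R -> R).
Hypothesis hG : transformation nu U g.
Local Notation mass A := (\int[nu]_(t in A) (g t)%:E)%E.
Local Notation G := (G nu g).
Local Notation Ginv := (Ginv nu U g).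

Let mg A : measurable_fun A (fun t : measurableTypeR R => (g t)%:E).
Proof. by apply: measurable_funTS; apply/measurable_EFinP; exact: (g_measurable hG). Qed.

Let mass_ge0 A : (0 <= mass A)%E.
Proof. by apply: integral_ge0 => t _; rewrite lee_fin (g_ge0 hG). Qed.

Let mass_le (A B : set (measurableTypeR R)) : measurable A -> measurable B ->
  A `<=` B -> (mass A <= mass B)%E.
Proof.
move=> mA mB AB; apply: ge0_subset_integral => //.
by move=> t _; rewrite lee_fin (g_ge0 hG).
Qed.

Let mass_fin A : measurable A -> mass A \is a fin_num.
Proof.
move=> mA; rewrite ge0_fin_numE ?mass_ge0 //.
by apply: (@le_lt_trans _ _ 1%E); rewrite ?ltry // -(g_mass hG) mass_le.
Qed.

Let massU (A B : set (measurableTypeR R)) : measurable A -> measurable B ->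
  A `&` B = set0 -> mass (A `|` B) = (mass A + mass B)%E.
Proof.
move=> mA mB AB; apply: ge0_integral_setU => //.
- by move=> t _; rewrite lee_fin (g_ge0 hG).
- by apply/disj_setPS; rewrite AB.
Qed.

Let mass_opp (A : set (measurableTypeR R)) : measurable A ->
  mass [set t | A (- t)%R] = mass A.
Proof.
move=> mA; have mopp : measurable_fun [set: measurableTypeR R]
    (-%R : measurableTypeR R -> measurableTypeR R) by exact: oppr_measurable.
transitivity (\int[pushforward nu (-%R : measurableTypeR R -> measurableTypeR R)]_(t in A) (g t)%:E)%E.
  rewrite (ge0_integral_pushforward mopp) //; last first.
    by move=> t _; rewrite lee_fin (g_ge0 hG).
  by apply: eq_integral => t _ /=; rewrite (g_even hG).
by apply: eq_measure_integral => // B mB _; exact: (symmetric_base hG).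
Qed.

Let mle (x : \bar R) : measurable ([set t : R | (t%:E <= x)%E] : set (measurableTypeR R)).
Proof.
case: x => [r| |].
- by under eq_set do rewrite lee_fin; rewrite -set_itvNyc; exact: measurable_itv.
- by rewrite (_ : [set _ | _] = setT) //; apply/seteqP; split => // t _ /=; rewrite leey.
- by rewrite (_ : [set _ | _] = set0) //; apply/seteqP; split => // t /=; rewrite leeNy_eq.
Qed.

Lemma G_nd (x y : \bar R) : (x <= y)%E -> G x <= G y.
Proof.
move=> xy; rewrite fine_le ?mass_fin // mass_le // => t /=.
by move=> tx; exact: le_trans xy.
Qed.

Lemma GNy : G -oo%E = 0.
Proof.
rewrite /G (_ : [set _ | _] = set0) ?integral_set0 //.
by apply/seteqP; split => // t /=; rewrite leeNy_eq.
Qed.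

Lemma Gy : G +oo%E = 1.
Proof.
rewrite /G (_ : [set _ | _] = setT) ?(g_mass hG) //.
by apply/seteqP; split => // t _ /=; rewrite leey.
Qed.

(* [G (- y) = 1 - G y] fails at the atoms of g dnu; the next two inequalities
   hold everywhere and replace it. *)
Lemma G_refl_ge (y : R) : 1 <= G y%:E + G (- y)%:E.
Proof.
rewrite /G -lee_fin EFinD !fineK; [|exact: mass_fin|exact: mass_fin].
(* By symmetry [G (- y)] is the mass of the half-line [t >= y]; together with [t <= y] it covers the
   line, and only an atom at [y] is counted twice. *)
rewrite -[X in (_ + X)%E]mass_opp // -(g_mass hG).
have mA : measurable ([set t : R | (t%:E < y%:E)%E] : set (measurableTypeR R)).
  by under eq_set do rewrite lte_fin; rewrite -set_itvNyo; exact: measurable_itv.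
have mB : measurable ([set t : R | ((- t)%R%:E <= (- y)%R%:E)%E] : set (measurableTypeR R)).
  under eq_set do rewrite lee_fin lerN2.
  by rewrite -set_itvcy; exact: measurable_itv.
apply: (@le_trans _ _ (mass ([set t : R | (t%:E < y%:E)%E] `|` [set t : R | ((- t)%R%:E <= (- y)%R%:E)%E]))).
  apply: mass_le; [by []|exact: measurableU|].
  move=> t _ /=; rewrite lte_fin lee_fin lerN2; by case: (ltP t y) => ty; [left|right].
rewrite massU // ?leeD2r //; last first.
  apply/seteqP; split => // t /= []; rewrite lte_fin lee_fin; lra.
by apply: mass_le => // t /=; exact: ltW.
Qed.

Lemma G_refl_le (y y' : R) : y < y' -> G y%:E + G (- y')%:E <= 1.
Proof.
move=> yy'; rewrite /G -lee_fin EFinD !fineK; [|exact: mass_fin|exact: mass_fin].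
rewrite -[X in (_ + X)%E]mass_opp // -(g_mass hG).
have mB : measurable ([set t : R | ((- t)%R%:E <= (- y')%R%:E)%E] : set (measurableTypeR R)).
  under eq_set do rewrite lee_fin lerN2.
  by rewrite -set_itvcy; exact: measurable_itv.
rewrite -massU //; last first.
  apply/seteqP; split => // t /= []; rewrite !lee_fin; lra.
by apply: mass_le => //; exact: measurableU.
Qed.

Lemma ereal_between (a b : \bar R) : (a < b)%E ->
  exists e : R, (a < e%:E)%E /\ (e%:E < b)%E.
Proof.
case: a b => [a| |] [b| |] //=; rewrite ?lte_fin => ab.
- by exists ((a + b) / 2); rewrite !lte_fin; split; lra.
- by exists (a + 1); rewrite ltry lte_fin; split => //; lra.
- by exists (b - 1); rewrite ltNyr lte_fin; split => //; lra.
- by exists 0; rewrite ltNyr ltry.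
Qed.

(** Strictness comes from a small interval inside the support: for [0 < e < min(y, U)],
    [G (e / 2) < G e <= G y], while [G_refl_ge] at [e / 2] and monotonicity give
    [1 <= 2 * G (e / 2)]. This also covers [y >= U]. *)
Lemma G_gt_half (y : R) : 0 < y -> 2^-1 < G y%:E.
Proof.
move=> y0; have [e [e0]] : exists e : R, (0 < e%:E)%E /\ (e%:E < Order.min y%:E U)%E.
  by apply: ereal_between; rewrite lt_min lte_fin y0 (U_gt0 hG).
rewrite lt_min => /andP[ey eU]; rewrite lte_fin in e0; rewrite lte_fin in ey.
have h1 : G (e / 2)%:E < G e%:E.
  apply: (G_increasing hG); [|lra|by []].
  apply: (@lt_trans _ _ 0%E); last by rewrite lte_fin; lra.
  by rewrite oppe_lt0 (U_gt0 hG).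
have h2 : G e%:E <= G y%:E by apply: G_nd; rewrite lee_fin ltW.
have h3 := G_refl_ge (e / 2).
have h4 : G (- (e / 2))%:E <= G (e / 2)%:E by apply: G_nd; rewrite lee_fin; lra.
lra.
Qed.

Lemma G_lt_half (y : R) : y < 0 -> G y%:E < 2^-1.
Proof.
move=> y0; have h1 : 2^-1 < G (- y / 2)%:E by apply: G_gt_half; lra.
have yy : y < y / 2 by lra.
have := G_refl_le yy; rewrite -mulNr; lra.
Qed.

Lemma Ginv_nd (q q' : R) : q <= q' -> (Ginv q <= Ginv q')%E.
Proof.
move=> qq'; apply: ereal_inf_le_tmp => x /= [xU q'x]; split => //.
exact: le_trans qq' q'x.
Qed.

(** This and [Ginv_gt] are read off the infimum, without right-continuity of [G]. The bounds on [e]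
    reflect that the infimum ranges over [[- U, U]]. *)
Lemma Ginv_lt (q e : R) : (- U < e%:E)%E -> (e%:E < U)%E ->
  (e%:E < Ginv q)%E -> G e%:E < q.
Proof.
move=> e1 e2 ec; rewrite ltNge; apply/negP => qG.
move: ec; rewrite ltNge => /negP; apply; apply: ereal_inf_lbound.
by split=> //=; rewrite !ltW.
Qed.

Lemma Ginv_gt (q e : R) : (Ginv q < e%:E)%E -> q <= G e%:E.
Proof.
move=> /ereal_inf_ltP[x [_ qx] xe]; apply: le_trans qx _.
exact/G_nd/ltW.
Qed.

(** The upper bound holds because [U] itself competes in the infimum: [g] vanishes beyond [U], so
    [G U] is already 1. *)
Lemma Ginv_bnd (q : R) : 0 <= q <= 1 -> (- U <= Ginv q)%E /\ (Ginv q <= U)%E.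
Proof.
move=> /andP[q0 q1]; split; first by apply/ereal_infP => x /= [/andP[]].
have UU : (- U <= U)%E.
  by rewrite (@le_trans _ _ 0%E) ?oppe_le0 // ltW ?(U_gt0 hG).
apply: ereal_inf_lbound; rewrite /= UU lexx; split => //.
apply: le_trans q1 _.
have -> : 1 = G +oo%E by rewrite Gy.
case: (eqVneq U +oo%E) => [->//|Uoo].
have mass0 : mass [set t : R | (U < t%:E)%E] = 0%E.
  by apply: integral0_eq => t /= Ut; rewrite (g_support hG) // negb_and -!leNgt (ltW Ut) orbT.
have mC : measurable ([set t : R | (U < t%:E)%E] : set (measurableTypeR R)).
  rewrite (_ : [set t | _] = ~` [set t : R | (t%:E <= U)%E]); first exact: measurableC.
  by apply/seteqP; split => t /=; rewrite ltNge => /negP.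
rewrite /G fine_le ?mass_fin //.
rewrite -[leRHS]adde0 -mass0 -massU //; last first.
  by apply/seteqP; split => // t /= [] /le_lt_trans h /h; rewrite ltxx.
apply: mass_le => //; first exact: measurableU.
by move=> t _ /=; case: (leP t%:E U) => tU; [left|right].
Qed.

Lemma GinvC (q : R) : 0 <= q <= 1 -> Ginv (1 - q) = (- Ginv q)%E.
Proof.
move=> q01; have q01' : 0 <= 1 - q <= 1 by lra.
have [c1 c2] := Ginv_bnd q01; have [d1 d2] := Ginv_bnd q01'.
apply/eqP; rewrite eq_le; apply/andP; split; rewrite leNgt; apply/negP => h.
- have [e [e1 e2]] := ereal_between h.
  have h1 : G e%:E < 1 - q.
    apply: (Ginv_lt _ _ e2); last exact: lt_le_trans e2 d2.
    by apply: le_lt_trans e1; rewrite leeN2.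
  have h2 : G (- e)%:E < q.
    apply: Ginv_lt; rewrite EFinN.
    - by rewrite lteN2; exact: lt_le_trans e2 d2.
    - by rewrite lteNl; apply: le_lt_trans e1; rewrite leeN2.
    - by rewrite lteNl.
  have := G_refl_ge e; lra.
(* Three points are needed here: strict growth of [G] from [e1] to [e2] provides the strict
   inequality, and the gap from [e2] to [e3] is what [G_refl_le] requires. *)
- have [e3 [de3 e3c]] := ereal_between h.
  have [e2 [de2 e23]] := ereal_between de3.
  have [e1 [de1 e12]] := ereal_between de2.
  rewrite lte_fin in e23; rewrite lte_fin in e12.
  have h1 : 1 - q <= G e1%:E by exact: Ginv_gt.
  have h2 : G e1%:E < G e2%:E.
    apply: (G_increasing hG) => //; first exact: le_lt_trans d1 de1.
    apply: (@lt_le_trans _ _ (- Ginv q)%E); last by rewrite leeNl.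
    by apply: lt_trans e3c; rewrite lte_fin.
  have h3 : q <= G (- e3)%:E by apply: Ginv_gt; rewrite EFinN lteNr.
  have := G_refl_le e23; lra.
Qed.

Lemma Ginv_ge0 (q : R) : 2^-1 <= q -> (0 <= Ginv q)%E.
Proof.
move=> q1; rewrite leNgt; apply/negP => h.
have [e [e1 e2]] := ereal_between h.
have := Ginv_gt e1; have := @G_lt_half e; rewrite lte_fin in e2.
move=> /(_ e2); lra.
Qed.

(** Since [1 - G (- y)] is the left limit of [G] at [y], the set consists of the jumps of [G]. The
    open intervals from [1 - G (- y)] to [G y] are pairwise disjoint by [G_refl_le], so picking a
    rational in each is injective. *)
Lemma countable_G_jumps : countable [set y : R | 1 < G y%:E + G (- y)%:E].
Proof.
set D := [set y | _].
have ex y : D y -> exists q : rat, 1 - G (- y)%:E < ratr q < G y%:E.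
  rewrite /D /= => Dy; have /rat_in_itvoo[q] : 1 - G (- y)%:E < G y%:E by lra.
  by rewrite in_itv /= => hq; exists q.
pose f y := if pselect (D y) is left Dy then pickle (sval (cid (ex y Dy))) else 0%N.
apply/countable_injP; exists f => y y' /[!inE] Dy Dy'; rewrite /f.
case: pselect => // Dy1; case: pselect => // Dy1'.
move/(pcan_inj pickleK).
case: cid => q /= /andP[q1 q2]; case: cid => q' /= /andP[q1' q2'] eq.
case: (ltgtP y y') => // lt; have := G_refl_le lt; rewrite -eq in q1' q2'; lra.
Qed.

Lemma measurable_Ginv : measurable_fun [set: R] Ginv.
Proof.
move=> mD; apply: (measurability _ (ErealGenInftyO.measurableE R)) => //.
move=> _ [_ [x ->] <-]; rewrite setTI; apply: is_interval_measurable.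
move=> a b /=; rewrite !in_itv /= => _ hb c /andP[_ cb].
exact: le_lt_trans (Ginv_nd cb) hb.
Qed.

Lemma measurable_add_noise d (T : measurableType d) (a b : T -> R) :
  measurable_fun setT a -> measurable_fun setT b ->
  measurable_fun setT (fun y => add_noise nu U g (a y) (b y)).
Proof.
move=> ma mb; rewrite /add_noise.
pose e y := (Ginv (a y) + (b y)%:E)%E.
have me : measurable_fun setT e.
  apply: emeasurable_funD; last exact/measurable_EFinP.
  exact: measurableT_comp measurable_Ginv ma.
(* Infinite quantiles, which occur at p-values 0 and 1 when [U = +oo], are split off; on the real
   line monotonicity of [G] gives measurability. *)
rewrite (_ : (fun y => _) = (fun y => if (e y == +oo)%E then 1 else
   if (e y == -oo)%E then 0 else G (fine (e y))%:E)); last first.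
  apply/funext => y; rewrite -/(e y); case: (e y) => [r| |] //=; [exact: Gy|exact: GNy].
have mE z : measurable_fun setT (fun y => e y == z).
  apply: (measurable_fun_bool true); rewrite setTI (_ : _ @^-1` _ = e @^-1` [set z]).
    by rewrite -[X in measurable X]setTI; exact: me.
  by apply/seteqP; split => y /= /eqP.
apply: measurable_fun_ifT => //; apply: measurable_fun_ifT => //.
apply: (measurableT_comp (f := fun r : R => G r%:E)).
  by apply: nondecreasing_measurable => // r s rs; exact: G_nd.
exact: measurableT_comp me.
Qed.

End transformation_facts.

(** * Comparison of measures and Gaussian noise *)

Lemma measurable_indicator d (T : measurableType d) (R : realType) (e : T -> bool) :
  measurable_fun setT e -> measurable_fun setT (fun y => (e y)%:R : R).
Proof.
move=> me; rewrite (_ : (fun y => _) = (fun y => if e y then 1 else 0)).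
  exact: measurable_fun_ifT.
by apply/funext => y; case: (e y).
Qed.

Definition pushforward_measure d d' (T : measurableType d) (T' : measurableType d')
    (R : realType) (m : {measure set T -> \bar R}) (f : T -> T')
    (mf : measurable_fun [set: T] f) : {measure set T' -> \bar R} :=
  measure_function_pushforward__canonical__measure_function_Measure m mf.

Section measure_comparison.
Local Open Scope ereal_scope.

Lemma ge0_le_measure_integral_in d (T : measurableType d) (R : realType)
    (m1 m2 : {measure set T -> \bar R}) (D : set T) (f : T -> \bar R) :
  measurable D -> (forall S, measurable S -> S `<=` D -> m1 S <= m2 S) ->
  (forall x, 0 <= f x) -> measurable_fun [set: T] f ->
  \int[m1]_(x in D) f x <= \int[m2]_(x in D) f x.
Proof.
move=> mD m12 f0 mf.
have restr (m : {measure set T -> \bar R}) :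
    \int[m]_(x in D) f x = \int[mrestr m mD]_(x in D) f x.
  by apply: eq_measure_integral => A mA AD; rewrite /= /mrestr setIidl.
rewrite (restr m1) (restr m2); apply: ge0_le_measure_integral => // S mS /=.
by apply: m12; [exact: measurableI|exact: subIsetr].
Qed.

(** The sets with [k A <= P A] need not be closed under complements, so no pi-lambda argument
    applies. The bound passes to Borel sets because [P] is an outer approximation by half-open
    intervals and [k] is countably subadditive. *)
Lemma measure_le_ocitv (R : realType)
    (P : probability (measurableTypeR R) R)
    (k : {measure set (measurableTypeR R) -> \bar R}) :
  (forall I, ocitv I -> k I <= P I) ->
  forall A, measurable A -> k A <= P A.
Proof.
move=> kP A mA; rewrite -(lebesgue_stieltjes_cdf_id P mA).
(* [P A] is now an infimum over countable covers of [A] by intervals. *)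
apply: le_ereal_inf_tmp => _ /= [F [mF AF] <-].
have mF' i : measurable (F i : set (measurableTypeR R)).
  exact: sub_sigma_algebra.
apply: (le_trans (measure_sigma_subadditive _ mF' mA AF)).
apply: lee_nneseries => i _ //.
rewrite (le_trans (kP _ (mF i))) // -(lebesgue_stieltjes_cdf_id P (mF' i)).
by rewrite /lebesgue_stieltjes_measure /measure_extension measurable_mu_extE.
Qed.

End measure_comparison.

Section gaussian.
Context {R : realType}.
Variable s : R.
Hypothesis s0 : s != 0.

Let mshift (c : R) : measurable_fun [set: measurableTypeR R]
  (fun w : measurableTypeR R => ((c + w)%R : measurableTypeR R)).
Proof. exact: measurable_funD. Qed.

Let mopp : measurable_fun [set: measurableTypeR R]
  (-%R : measurableTypeR R -> measurableTypeR R).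
Proof. exact: oppr_measurable. Qed.

Lemma lebesgue_measure_shift (c : R) (A : set (measurableTypeR R)) :
  measurable A ->
  pushforward lebesgue_measure
    (fun w : measurableTypeR R => ((c + w)%R : measurableTypeR R)) A =
  lebesgue_measure A.
Proof.
move=> mA; apply/esym.
apply: (@lebesgue_measure_unique R
  (pushforward_measure lebesgue_measure (mshift c))) => //.
move=> _ [[a b] /= _ <-]; rewrite /pushforward.
rewrite (_ : _ @^-1` _ = `]a - c, b - c]%classic).
  rewrite !lebesgue_measure_itv /= !lte_fin ltrD2r; case: ifP => // _.
  by rewrite -!EFinB; congr (_%:E); lra.
by apply/seteqP; split => w /=; rewrite !in_itv /=; lra.
Qed.

Lemma normal_prob_shift (c : R) (A : set (measurableTypeR R)) : measurable A ->
  normal_prob 0 s [set w : R | A (c + w)%R] = normal_prob c s A.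
Proof.
move=> mA; rewrite /normal_prob.
transitivity (\int[pushforward lebesgue_measure
    (fun w : measurableTypeR R => ((c + w)%R : measurableTypeR R))]_(x in A)
    (normal_pdf c s x)%:E)%E; last first.
  by apply: eq_measure_integral => // B mB _; exact: lebesgue_measure_shift.
have mpdf : measurable_fun A (fun x : measurableTypeR R => (normal_pdf c s x)%:E).
  by apply/measurable_funTS/measurable_EFinP; exact: measurable_normal_pdf.
have pdf0 : {in A, forall x : measurableTypeR R, (0 <= (normal_pdf c s x)%:E)%E}.
  by move=> y _; rewrite lee_fin normal_pdf_ge0.
rewrite (ge0_integral_pushforward (mshift c) lebesgue_measure mA mpdf pdf0).
have pdfE (w : R) : normal_pdf 0 s w = normal_pdf c s (c + w).
  by rewrite !normal_pdfE // /normal_fun subr0 addrAC subrr add0r.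
by apply: eq_integral => w _; rewrite pdfE.
Qed.

Lemma normal_prob_opp (c : R) (A : set (measurableTypeR R)) : measurable A ->
  normal_prob c s [set w : R | A (- w)%R] = normal_prob (- c) s A.
Proof.
move=> mA; rewrite /normal_prob.
transitivity (\int[pushforward lebesgue_measure
    (-%R : measurableTypeR R -> measurableTypeR R)]_(x in A)
    (normal_pdf (- c) s x)%:E)%E; last first.
  by apply: eq_measure_integral => // B mB _; exact: lebesgue_measureN.
have mpdf : measurable_fun A (fun x : measurableTypeR R => (normal_pdf (- c) s x)%:E).
  by apply/measurable_funTS/measurable_EFinP; exact: measurable_normal_pdf.
have pdf0 : {in A, forall x : measurableTypeR R, (0 <= (normal_pdf (- c) s x)%:E)%E}.
  by move=> y _; rewrite lee_fin normal_pdf_ge0.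
rewrite (ge0_integral_pushforward mopp lebesgue_measure mA mpdf pdf0).
have pdfE (w : R) : normal_pdf c s w = normal_pdf (- c) s (- w).
  by rewrite !normal_pdfE // /normal_fun -[in RHS]sqrrN opprB opprK addrC.
by apply: eq_integral => w _; rewrite pdfE.
Qed.

Lemma normal_prob_le (c : R) (A : set (measurableTypeR R)) : 0 <= c ->
  measurable A -> A `<=` [set y | y <= 0] ->
  (normal_prob c s A <= normal_prob (- c) s A)%E.
Proof.
move=> c0 mA A0; apply: ge0_le_integral => //.
- by move=> y _; rewrite lee_fin normal_pdf_ge0.
- by apply/measurable_funTS/measurable_EFinP; exact: measurable_normal_pdf.
- by apply/measurable_funTS/measurable_EFinP; exact: measurable_normal_pdf.
suff pdf_le (y : R) : y <= 0 -> normal_pdf c s y <= normal_pdf (- c) s y.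
  by move=> y Ay; rewrite lee_fin; apply: pdf_le; exact: (A0 _ Ay).
move=> y0; rewrite !normal_pdfE // /normal_fun ler_wpM2l ?normal_peak_ge0 // ler_expR.
rewrite ler_wpM2r ?invr_ge0 ?mulrn_wge0 ?sqr_ge0 // lerN2.
nra.
Qed.

Lemma integral_normal_shift (c : R) (f : R -> \bar R) :
  measurable_fun [set: R] f -> (forall y, 0 <= f y)%E ->
  (\int[normal_prob 0 s]_w f (c + w)%R = \int[normal_prob c s]_y f y)%E.
Proof.
move=> mf f0.
transitivity (\int[pushforward (normal_prob 0 s)
    (fun w : measurableTypeR R => ((c + w)%R : measurableTypeR R))]_y f y)%E.
  by rewrite (ge0_integral_pushforward (mshift c)).
by apply: eq_measure_integral => B mB _; exact: normal_prob_shift.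
Qed.

Lemma integral_normal_opp (f : R -> \bar R) :
  measurable_fun [set: R] f -> (forall y, 0 <= f y)%E ->
  (\int[normal_prob 0 s]_w f (- w)%R = \int[normal_prob 0 s]_y f y)%E.
Proof.
move=> mf f0.
transitivity (\int[pushforward (normal_prob 0 s)
    (-%R : measurableTypeR R -> measurableTypeR R)]_y f y)%E.
  by rewrite (ge0_integral_pushforward mopp).
apply: eq_measure_integral => // B mB _.
by have := normal_prob_opp 0 mB; rewrite oppr0.
Qed.

End gaussian.

Section noise_reflection.
Context {R : realType}.
Variables (nu : {measure set (measurableTypeR R) -> \bar R}) (U : \bar R)
  (g : R -> R).
Hypothesis hG : transformation nu U g.
Local Notation G := (G nu g).
Local Notation Ginv := (Ginv nu U g).
Variable s : R.
Hypothesis s0 : s != 0.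
Variable h : R -> R.
Hypotheses (mh : measurable_fun setT h) (h0 : forall b, 0 <= h b)
  (hC : forall b, h (1 - b) = h b).

Let half0 : (0 <= 2^-1 :> R). Proof. by rewrite invr_ge0. Qed.
Let half1 : (2^-1 < 1 :> R). Proof. by rewrite invf_lt1 ?ltr1n. Qed.

Let low (b : R) : \bar R := ((b <= 2^-1)%R%:R * h b)%:E.
Let high (b : R) : \bar R := ((2^-1 < b)%R%:R * h b)%:E.

Let mind (f : R -> bool) : measurable_fun setT f ->
  measurable_fun setT (fun b : R => ((f b)%:R * h b)%:E).
Proof.
move=> mf; apply/measurable_EFinP; apply: measurable_funM => //.
exact: measurable_indicator.
Qed.

Let mlow : measurable_fun setT low.
Proof. by apply: mind; exact: measurable_fun_ler. Qed.

Let mhigh : measurable_fun setT high.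
Proof. by apply: mind; exact: measurable_fun_ltr. Qed.

Let low0 b : (0 <= low b)%E. Proof. by rewrite lee_fin mulr_ge0. Qed.
Let high0 b : (0 <= high b)%E. Proof. by rewrite lee_fin mulr_ge0. Qed.

Let mG : measurable_fun setT (fun y : R => G y%:E).
Proof. by apply: nondecreasing_measurable => // r t rt; apply: (G_nd hG). Qed.

(** Replacing [w] by [- w] turns [- c + w] into [- (c + w)], hence [G (c + w)] into its complement
    almost everywhere, and [h] does not see complements. For infinite [c] both integrands are
    constant. *)
Lemma noise_flip (c : \bar R) :
  (\int[normal_prob 0 s]_w low (G (- c + w%:E)) =
   \int[normal_prob 0 s]_w high (G (c + w%:E)))%E.
Proof.
case: c => [c| |] /=; last 2 first.
- apply: eq_integral => w _; rewrite /= (GNy nu g) (Gy hG) /low /high.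
  by rewrite -(hC 1) subrr half0 half1.
- apply: eq_integral => w _; rewrite /= (GNy nu g) (Gy hG) /low /high.
  by rewrite leNgt half1 ltNge half0 !mul0r.
rewrite -(integral_normal_opp s0 (f := fun w => low (G (- c + w)%:E))); last 2 first.
- by apply: (measurableT_comp mlow); apply: (measurableT_comp (f := fun y : R => G y%:E) mG); exact: measurable_funD.
- by move=> w; exact: low0.
(* Besides the jumps, the point [c + w = 0] is excluded: only there can [G] equal 1/2, where
   complementing does not exchange [<= 1/2] and [> 1/2]. *)
pose N := [set w : R | c + w = 0] `|`
  [set w : R | 1 < G (c + w)%:E + G (- (c + w))%:E].
have cN : countable N.
  have /countable_injP[f fi] := countable_G_jumps hG.
  apply/countable_injP; exists (fun w => if c + w == 0 then 0%N else (f (c + w)).+1).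
  move=> w w' /[!inE] Nw Nw'; case: eqP => [e0|w0]; case: eqP => [e0'|w0'] //.
    by move=> _; apply: (addrI c); rewrite e0.
  case: Nw => // Dw; case: Nw' => // Dw' [e].
  by apply: (addrI c); apply: fi => //; rewrite inE.
have madd (b : R) : measurable_fun setT (fun w : R => b + w).
  exact: measurable_funD.
have mN (b : R) : measurable_fun setT (fun w : R => b - w).
  exact: measurable_funB.
apply: ge0_ae_eq_integral => //.
- exact: (measurableT_comp mlow (measurableT_comp (f := fun y : R => G y%:E) mG (mN (- c)))).
- exact: (measurableT_comp mhigh (measurableT_comp (f := fun y : R => G y%:E) mG (madd c))).
exists N; split.
- exact: countable_measurable.
- have /null_content_dominatesP := normal_prob_dominates (0 : R) s.
  by apply; [exact: countable_measurable|exact: countable_lebesgue_measure0].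
- move=> w /= hw; apply: contrapT => Nw; apply: hw => _.
  have [y0 /negP] : c + w <> 0 /\ ~ (1 < G (c + w)%:E + G (- (c + w))%:E).
    by split=> hw; apply: Nw; [left|right].
  rewrite -leNgt => le1; have ge1 := G_refl_ge hG (c + w).
  have -> : - c - w = - (c + w) by lra.
  have -> : G (- (c + w))%:E = 1 - G (c + w)%:E by lra.
  rewrite /low /high hC; congr ((nat_of_bool _)%:R * _)%:E.
  have [y1|y1|//] := ltgtP (c + w) 0.
  - have := G_lt_half hG y1; lra.
  - have := G_gt_half hG y1; lra.
Qed.

(** The integrand lives on [y <= 0], as [G y > 1/2] beyond; there the Gaussian centered at [- c] has
    the larger density. For [c = +oo] the left integrand is zero. *)
Lemma noise_mono (c : \bar R) : (0 <= c)%E ->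
  (\int[normal_prob 0 s]_w low (G (c + w%:E)) <=
   \int[normal_prob 0 s]_w low (G (- c + w%:E)))%E.
Proof.
case: c => [c c0|_|h0y] /=; last 2 first.
- rewrite [leLHS](_ : _ = 0%E); first by apply: integral_ge0 => w _; exact: low0.
  apply: integral0_eq => w _; rewrite /= (Gy hG) /low.
  by rewrite leNgt half1 mul0r.
- by exfalso; move: h0y; rewrite leeNy_eq.
have mf : measurable_fun setT (fun y : R => low (G y%:E)).
  exact: measurableT_comp mG.
have shift c' := integral_normal_shift s0 c' mf (fun y => low0 (G y%:E)).
rewrite [leLHS](shift c) [leRHS](shift (- c)).
have restr c' : (\int[normal_prob c' s]_y low (G y%:E) =
   \int[normal_prob c' s]_(y in `]-oo, 0%R]) low (G y%:E))%E.
  rewrite [RHS]integral_mkcond; apply: eq_integral => y _; rewrite patchE.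
  case: ifPn => //; rewrite notin_setE /= in_itv /= => /negP; rewrite -ltNge => y0.
  have := G_gt_half hG y0; rewrite /low ltNge => /negbTE ->.
  by rewrite mul0r.
rewrite [leLHS](restr c) [leRHS](restr (- c)); apply: ge0_le_measure_integral_in.
- exact: measurable_itv.
- move=> S mS S0; apply: (normal_prob_le s0 c0 mS) => y /S0 /=.
  by rewrite in_itv.
- by move=> y; exact: low0.
- exact: mf.
Qed.

End noise_reflection.

(** * Mirror-conservative p-values *)

Section mirror.
Context {R : realType}.
Variable mu : probability (measurableTypeR R) R.
Hypothesis mu01 : mu (~` `[0, 1]%classic) = 0%E.
Hypothesis mu_mirror : forall a1 a2 : R, 0 <= a1 -> a1 <= a2 -> a2 <= 2^-1 ->
  (mu `[a1, a2]%classic <= mu `[(1 - a2)%R, (1 - a1)%R]%classic)%E.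

Let mC : measurable_fun [set: measurableTypeR R]
  (fun p : measurableTypeR R => ((1 - p)%R : measurableTypeR R)).
Proof. exact: measurable_funB. Qed.

Let k : {measure set (measurableTypeR R) -> \bar R} :=
  pushforward_measure mu mC.

Let mu_support (A : set (measurableTypeR R)) : measurable A ->
  mu A = mu (A `&` `[0, 1]%classic).
Proof.
move=> mA; rewrite -{1}(setIT A) -(setUv `[0%R, 1%R]%classic) setIUr measureU //.
- rewrite [X in (_ + X)%E](_ : _ = 0%E) ?adde0 //; apply/eqP; rewrite -measure_le0 -mu01.
  by apply: le_measure; rewrite ?inE //; [apply: measurableI => //|]; exact: measurableC.
- by apply: measurableI.
- by apply: measurableI => //; exact: measurableC.
- by rewrite setIACA setICr setI0.
Qed.

Lemma mirror_dominated (A : set (measurableTypeR R)) : measurable A ->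
  A `<=` [set p | 2^-1 < p] -> (mu [set p : R | A (1 - p)%R] <= mu A)%E.
Proof.
move=> mA Ahalf.
pose H : set (measurableTypeR R) := `]2^-1, +oo[%classic.
have mH : measurable H by exact: measurable_itv.
have mH' : measurable (~` H) by exact: measurableC.
(* A measure comparison is tested on half-open intervals, while the hypothesis concerns closed ones:
   the former are increasing unions of the latter. *)
have key (a b : R) : 2^-1 <= a -> b <= 1 -> (k `]a, b]%classic <= mu `]a, b]%classic)%E.
  move=> ha hb; rewrite [in leLHS]itv_open_bnd_bigcup.
  have mI n : measurable (`[a + n.+1%:R^-1, b]%classic : set (measurableTypeR R)) by exact: measurable_itv.
  have cv : (k \o (fun n => `[a + n.+1%:R^-1, b]%classic : set (measurableTypeR R))) @ \oo
      --> k (\bigcup_n `[a + n.+1%:R^-1, b]%classic).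
    apply: nondecreasing_cvg_mu => //; first exact: bigcup_measurable.
    move=> n n' nn'; apply/subsetPset => x /=; rewrite !in_itv /= => /andP[h1 ->].
    rewrite andbT; apply: le_trans h1; rewrite lerD2l lef_pV2 ?posrE ?ltr0n //.
    by rewrite ler_nat.
  rewrite -(cvg_lim _ cv) //; apply: lime_le; first by apply/cvg_ex; eexists; exact: cv.
  apply: nearW => n /=.
  have [ab|ab] := leP (a + n.+1%:R^-1) b; last first.
    by rewrite set_itv_ge ?measure0 ?measure_ge0 // bnd_simp -ltNge.
  have n0 : 0 < n.+1%:R^-1 :> R by rewrite invr_gt0 ltr0n.
  move: (n.+1%:R^-1) n0 ab => e e0 ab.
  apply: (@le_trans _ _ (mu `[(1 - b)%R, (1 - (a + e))%R]%classic)).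
    rewrite /k /= /pushforward le_measure ?inE //.
    - by rewrite -[X in measurable X]setTI; exact: mC.
    - move=> p /=; rewrite !in_itv /= => /andP[h1 h2]; apply/andP; split; lra.
  apply: (le_trans (mu_mirror _ _ _)); [lra|lra|lra|].
  by rewrite le_measure ?inE // => p /=; rewrite !in_itv /= => /andP[h1 h2]; apply/andP; split; lra.
(* The comparison is available only to the right of 1/2, but [measure_le_ocitv] asks for all
   intervals. The reflected law on [H] is therefore completed by [mu] itself off [H]. *)
have kmu (I : set R) : ocitv I ->
    (measure_add (mrestr k mH) (mrestr mu mH') I <= mu I)%E.
  move=> [[a b] /= _ <-].
  have mI : measurable (`]a, b]%classic : set (measurableTypeR R)) by exact: measurable_itv.
  rewrite measure_addE /= /mrestr.
  rewrite -[in leRHS](setIT `]a, b]%classic) -(setUv H) setIUr.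
  rewrite [leRHS]measureU; [|exact: measurableI|exact: measurableI|by rewrite setIACA setICr setI0].
  rewrite leeD2r //.
  have -> : `]a, b]%classic `&` H = `]Num.max a 2^-1, b]%classic.
    rewrite /H; apply/seteqP; split => p /=; rewrite !in_itv /= gt_max andbT.
      by move=> [/andP[-> ->] ->].
    by move=> /andP[/andP[-> ->] ->].
  (* Cutting at 1 loses no mass, since [mu] lives on [[0, 1]], and makes [key] applicable. *)
  have ksup : k `]Num.max a 2^-1, b]%classic = k `]Num.max a 2^-1, Num.min b 1]%classic.
    rewrite /k /= /pushforward mu_support; last by rewrite -[X in measurable X]setTI; exact: mC.
    rewrite [RHS]mu_support; last by rewrite -[X in measurable X]setTI; exact: mC.
    congr (mu _); apply/seteqP; split => p /=; rewrite !in_itv /= le_min; case=> /andP[h1 h2] h3;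
      split => //; apply/andP; split => //; move: h2 h3; lra.
  rewrite ksup; apply: (le_trans (key _ _ _ _)).
  - by rewrite le_max lexx orbT.
  - by rewrite ge_min lexx orbT.
  - by rewrite le_measure ?inE // => p /=; rewrite !in_itv /= le_min => /andP[-> /andP[->]].
have : (measure_add (mrestr k mH) (mrestr mu mH') A <= mu A)%E.
  exact: (measure_le_ocitv kmu mA).
rewrite measure_addE /= /mrestr /= (setIidl (B := H)); last first.
  by move=> p /Ahalf; rewrite /H /= in_itv /= andbT.
rewrite [X in (_ + X)%E](_ : _ = 0%E) ?adde0 //.
rewrite (_ : A `&` ~` H = set0) ?measure0 //.
by apply/seteqP; split => // p [/Ahalf /= h]; rewrite /H /= in_itv /= andbT h.
Qed.

End mirror.

Section mirror_integral.
Context {R : realType}.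
Variables (nu : {measure set (measurableTypeR R) -> \bar R}) (U : \bar R)
  (g : R -> R).
Hypothesis hG : transformation nu U g.
Variable s : R.
Hypothesis s0 : s != 0.
Variable mu : probability (measurableTypeR R) R.
Hypothesis mu01 : mu (~` `[0, 1]%classic) = 0%E.
Hypothesis mu_mirror : forall a1 a2 : R, 0 <= a1 -> a1 <= a2 -> a2 <= 2^-1 ->
  (mu `[a1, a2]%classic <= mu `[(1 - a2)%R, (1 - a1)%R]%classic)%E.
Variable K : R -> R -> R.
Hypotheses (mK : measurable_fun setT
    (fun z : measurableTypeR R * measurableTypeR R => K z.1 z.2))
  (K0 : forall p b, 0 <= K p b) (K1 : forall p b, K p b <= 1)
  (KC : forall p b, K (1 - p) b = K p b).
Local Notation a := (add_noise nu U g).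
Local Notation N := (normal_prob (0 : R) s).

(** In the application [K] is the leave-one-out weight times the indicator of a given selection, all
    other variables frozen. It reads the released value through its folding, which makes [h p]
    symmetric about 1/2. *)
Let h (p b : R) : R := K p (Num.min b (1 - b)).
Let flow (z : measurableTypeR R * measurableTypeR R) : \bar R :=
  ((a z.1 z.2 <= 2^-1)%R%:R * h z.1 (a z.1 z.2))%:E.
Let fhigh (z : measurableTypeR R * measurableTypeR R) : \bar R :=
  ((2^-1 < a z.1 z.2)%R%:R * h z.1 (a z.1 z.2))%:E.
Let Flow (p : measurableTypeR R) : \bar R := (\int[N]_w flow (p, w))%E.
Let Fhigh (p : measurableTypeR R) : \bar R := (\int[N]_w fhigh (p, w))%E.

Let hC p b : h p (1 - b) = h p b.
Proof. by rewrite /h minC subKr. Qed.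

Let h0 p b : 0 <= h p b. Proof. exact: K0. Qed.

Let mmin (d : measure_display) (T : measurableType d) (f : T -> R) :
  measurable_fun setT f -> measurable_fun setT (fun y => Num.min (f y) (1 - f y)).
Proof.
by move=> mf; apply: measurable_minr => //; apply: measurable_funB.
Qed.

Let mh p : measurable_fun setT (h p).
Proof.
apply: (measurableT_comp mK (g := fun b : measurableTypeR R => ((p, Num.min b (1 - b)) : measurableTypeR R * measurableTypeR R))).
apply/measurable_fun_pairP; split; first exact: measurable_cst.
by apply: (@mmin _ (measurableTypeR R) (fun b => b)); exact: measurable_id.
Qed.

Let ma : measurable_fun setT
  (fun z : measurableTypeR R * measurableTypeR R => a z.1 z.2).
Proof. by apply: (measurable_add_noise hG). Qed.

Let mha : measurable_fun setT
  (fun z : measurableTypeR R * measurableTypeR R => h z.1 (a z.1 z.2)).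
Proof.
apply: (measurableT_comp mK
  (g := fun z : measurableTypeR R * measurableTypeR R => ((z.1, Num.min (a z.1 z.2) (1 - a z.1 z.2)) : measurableTypeR R * measurableTypeR R))).
apply/measurable_fun_pairP; split; first exact: measurable_fst.
by apply: (@mmin _ (measurableTypeR R * measurableTypeR R)%type (fun z => a z.1 z.2)); exact: ma.
Qed.

Let mindic (f : measurableTypeR R * measurableTypeR R -> bool) :
  measurable_fun setT f ->
  measurable_fun setT (fun z => ((f z)%:R * h z.1 (a z.1 z.2))%:E).
Proof.
move=> mf; apply/measurable_EFinP; apply: measurable_funM => //.
exact: measurable_indicator.
Qed.

Let measurable_flow : measurable_fun setT flow.
Proof. by apply: mindic; exact: measurable_fun_ler. Qed.

Let measurable_fhigh : measurable_fun setT fhigh.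
Proof. by apply: mindic; exact: measurable_fun_ltr. Qed.

Let flow0 z : (0 <= flow z)%E. Proof. by rewrite lee_fin mulr_ge0. Qed.
Let fhigh0 z : (0 <= fhigh z)%E. Proof. by rewrite lee_fin mulr_ge0. Qed.
Let fle1 (b : bool) p c : (((b%:R * h p c)%:E : \bar R) <= 1)%E.
Proof. by rewrite lee_fin; case: b; rewrite ?mul1r ?mul0r ?K1. Qed.

Let mFlow : measurable_fun setT Flow.
Proof. exact: (measurable_fun_fubini_tonelli_F (m2 := N) _ measurable_flow flow0). Qed.
Let mFhigh : measurable_fun setT Fhigh.
Proof. exact: (measurable_fun_fubini_tonelli_F (m2 := N) _ measurable_fhigh fhigh0). Qed.
Let Flow0 p : (0 <= Flow p)%E. Proof. exact: integral_ge0. Qed.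
Let Fhigh0 p : (0 <= Fhigh p)%E. Proof. exact: integral_ge0. Qed.

Let int_le1 (m : probability (measurableTypeR R) R) (f : measurableTypeR R -> \bar R) :
  measurable_fun setT f -> (forall x, 0 <= f x)%E -> (forall x, f x <= 1)%E ->
  (\int[m]_x f x <= 1)%E.
Proof.
move=> mf f0 f1; apply: (@le_trans _ _ (\int[m]_x (cst 1 x))%E).
  by apply: ge0_le_integral.
by rewrite integral_cst // mul1e probability_le1.
Qed.

Let section_meas f p : measurable_fun [set: measurableTypeR R * measurableTypeR R] f ->
  measurable_fun [set: measurableTypeR R] (fun w : measurableTypeR R => f (p, w) : \bar R).
Proof. by move=> mf; apply: (measurableT_comp mf); exact: measurable_pair1. Qed.

Let Flow1 p : (Flow p <= 1)%E.
Proof.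
apply: int_le1 => //; first exact: (section_meas p measurable_flow).
by move=> w; exact: fle1.
Qed.

Let Fhigh1 p : (Fhigh p <= 1)%E.
Proof.
apply: int_le1 => //; first exact: (section_meas p measurable_fhigh).
by move=> w; exact: fle1.
Qed.

Let FlowC (p : R) : 0 <= p <= 1 -> Flow (1 - p) = Fhigh p.
Proof.
move=> p01; rewrite /Flow /Fhigh /flow /fhigh /=.
have hp : h (1 - p) = h p by apply/funext => b; rewrite /h KC.
rewrite hp /add_noise (GinvC hG p01).
exact: (noise_flip hG s0 (mh p) (h0 p) (hC p)).
Qed.

Let Flow_le (p : R) : 2^-1 <= p -> (Flow p <= Fhigh p)%E.
Proof.
move=> p12; have c0 := Ginv_ge0 hG p12.
rewrite /Flow /Fhigh /flow /fhigh /= /add_noise.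
rewrite -(noise_flip hG s0 (mh p) (h0 p) (hC p)).
exact: (noise_mono hG s0 (mh p) (h0 p)).
Qed.

(** Reflection exchanges [Flow] and [Fhigh] between [p] and [1 - p], so the deficit of [Fhigh] at
    [p < 1/2] equals its excess [D] at [1 - p]. The excess is nonnegative, and the law of [p] puts
    at least as much mass on each Borel set to the right of 1/2 as on its reflection. *)
Lemma mirror_integral :
  (\int[mu]_p \int[N]_w ((a p w <= 2^-1)%R%:R * K p (Num.min (a p w) (1 - a p w)))%:E
   <= \int[mu]_p \int[N]_w ((2^-1 < a p w)%R%:R * K p (Num.min (a p w) (1 - a p w)))%:E)%E.
Proof.
change (\int[mu]_p Flow p <= \int[mu]_p Fhigh p)%E.
pose H : set (measurableTypeR R) := `]2^-1, +oo[%classic.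
have mH : measurable H by exact: measurable_itv.
pose D (p : measurableTypeR R) : \bar R := if 2^-1 < p then (Fhigh p - Flow p)%E else 0%E.
have Ffin p : Flow p \is a fin_num.
  by rewrite ge0_fin_numE // (le_lt_trans (Flow1 p)) // ltry.
have Ffin' p : Fhigh p \is a fin_num.
  by rewrite ge0_fin_numE // (le_lt_trans (Fhigh1 p)) // ltry.
have D0 p : (0 <= D p)%E.
  rewrite /D; case: ifPn => [p12|_]; last exact: lexx.
  by rewrite sube_ge0 ?Ffin ?orbT; [apply: Flow_le; exact: ltW|].
have D1 p : (D p <= 1)%E.
  rewrite /D; case: ifPn => // _; apply: le_trans (Fhigh1 p).
  by rewrite leeBlDr // leeDl.
have mD : measurable_fun setT D.
  apply: measurable_fun_ifT => //; first exact: measurable_fun_ltr.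
  exact: emeasurable_funB.
pose C (p : measurableTypeR R) : measurableTypeR R := 1 - p.
have mC : measurable_fun setT C by exact: measurable_funB.
have mDC : measurable_fun setT (D \o C) by exact: measurableT_comp.
have DC_le : (\int[mu]_p D (C p) <= \int[mu]_p D p)%E.
  pose k : {measure set (measurableTypeR R) -> \bar R} :=
    pushforward_measure mu mC.
  have Dres (m : {measure set (measurableTypeR R) -> \bar R}) :
      (\int[m]_p D p = \int[m]_(p in H) D p)%E.
    rewrite [RHS]integral_mkcond; apply: eq_integral => p _; rewrite patchE.
    case: ifPn => //; rewrite notin_setE /H /= in_itv /= andbT => /negP/negbTE.
    by rewrite /D => ->.
  have eqle (u v : \bar R) : u = v -> (u <= v)%E by move=> ->.
  have push : (\int[k]_p D p = \int[mu]_p D (C p))%E.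
    exact: (ge0_integral_pushforward mC mu measurableT mD (fun p _ => D0 p)).
  have kmu S : measurable S -> S `<=` H -> (k S <= mu S)%E.
    move=> mS SH; apply: (mirror_dominated mu01 mu_mirror mS) => p /SH.
    by rewrite /H /= in_itv /= andbT.
  have le := @ge0_le_measure_integral_in _ _ _ k mu H D mH kmu D0 mD.
  apply: (le_trans (eqle _ _ (esym push))).
  apply: (le_trans (eqle _ _ (Dres k))).
  exact: (le_trans le (eqle _ _ (esym (Dres mu)))).
(* [Flow p + D p = Fhigh p + D (1 - p)] on [0, 1], and the law of [p] puts more
   mass on the support of [D] than on its mirror image. *)
have sk (u v : \bar R) : u \is a fin_num -> (u + (v - u) = v)%E.
  by move=> uf; rewrite addeC subeK.
have sk' (u v u' v' : \bar R) : v \is a fin_num -> u' = v -> u = v' ->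
    (u + 0 = v + (v' - u'))%E.
  by move=> vf -> ->; rewrite adde0 sk.
have E : (\int[mu]_p (Flow p + D p) = \int[mu]_p (Fhigh p + D (C p)))%E.
  have mFD : measurable_fun setT (fun p => Flow p + D p)%E.
    exact: (emeasurable_funD mFlow mD).
  have mFD' : measurable_fun setT (fun p => Fhigh p + D (C p))%E.
    exact: (emeasurable_funD mFhigh mDC).
  apply: (ge0_ae_eq_integral measurableT mFD mFD').
  - by move=> p _; apply: adde_ge0.
  - by move=> p _; apply: adde_ge0.
  exists (~` `[0, 1]%classic); split => //; first by apply: measurableC.
  move=> p /= np hp; apply: np => _; move: hp; rewrite in_itv /= => p01.
  have p01' : 0 <= 1 - p <= 1 by lra.
  have e1 := FlowC p01; have := FlowC p01'; rewrite subKr => e2.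
  rewrite /D /C; have [p12|p12|pe] := ltgtP 2^-1 p.
  - rewrite ifF; last by apply/negbTE; rewrite -leNgt; lra.
    exact: etrans (sk _ _ (Ffin p)) (esym (adde0 _)).
  - rewrite ifT; last by lra.
    exact: (sk' _ _ _ _ (Ffin' p) e1 e2).
  - rewrite ifF; last by apply/negbTE; rewrite -leNgt; lra.
    have pp : 1 - p = p by rewrite -pe; lra.
    by rewrite pp in e1; exact: (congr1 (fun u : \bar R => (u + 0)%E) e1).
(* The balance is kept as an equality of sums; finiteness of the integral of [D] permits cancelling
   it. *)
have IDfin : (\int[mu]_p D p)%E \is a fin_num.
  rewrite ge0_fin_numE; last exact: integral_ge0.
  by apply: (@le_lt_trans _ _ 1%E); [exact: int_le1|rewrite ltry].
have add (f f' : measurableTypeR R -> \bar R) : measurable_fun setT f ->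
    measurable_fun setT f' -> (forall p, 0 <= f p)%E -> (forall p, 0 <= f' p)%E ->
    (\int[mu]_p (f p + f' p) = \int[mu]_p f p + \int[mu]_p f' p)%E.
  by move=> mf mf' f0 f0'; apply: ge0_integralD.
have E1 := add _ _ mFlow mD Flow0 D0.
have E2 := add _ _ mFhigh mDC Fhigh0 (fun p => D0 (C p)).
have fin (u v ID IF IF' IDC : \bar R) : u = v -> (u = IF + ID)%E ->
    (v = IF' + IDC)%E -> ID \is a fin_num -> (IDC <= ID)%E -> (IF <= IF')%E.
  by move=> -> -> e IDf le; rewrite -(leeD2rE _ _ IDf) e leeD2l.
exact: (fin _ _ _ _ _ _ E E1 E2 IDfin DC_le).
Qed.

End mirror_integral.

(** * Independent coordinates *)

Section independence.
Local Open Scope ereal_scope.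
Context d (T : measurableType d) (R : realType) (P : probability T R).

(** As functions of [E], both sides are finite measures that agree on a pi-system containing the
    whole space. *)
Lemma independent_g_sigma (A : set T) (G : set (set T)) :
  measurable A -> G `<=` measurable -> setI_closed G -> G setT ->
  (forall E, G E -> P (A `&` E) = P A * P E) ->
  forall E, <<s G >> E -> P (A `&` E) = P A * P E.
Proof.
move=> mA Gm GI GT AE E sE.
have PA : P A \is a fin_num by exact: fin_num_measure.
pose r : {nonneg R} := NngNum (fine_ge0 (measure_ge0 P A)).
have rE B : mscale r P B = P A * P B by rewrite /mscale /= fineK.
rewrite -rE setIC -[LHS]/(mrestr P mA E).
apply: (@g_sigma_algebra_measure_unique _ R T G Gm (fun=> setT) _ _
  (mrestr P mA) (mscale r P)) => //.
- by rewrite bigcup_const.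
- by move=> B GB; rewrite /= /mrestr setIC AE // -rE.
- by move=> _; rewrite /= /mrestr setTI; apply: (le_lt_trans (probability_le1 P mA)); rewrite ltry.
Qed.

Variables (p w : {mfun T >-> measurableTypeR R}) (G : set (set T)).
Hypotheses (Gm : G `<=` measurable) (GI : setI_closed G) (GT : G setT).
Hypothesis indep : forall A B E, measurable A -> measurable B -> G E ->
  P ((p @^-1` A `&` w @^-1` B) `&` E) =
  P (p @^-1` A) * P (w @^-1` B) * P E.

Let mpre (f : {mfun T >-> measurableTypeR R}) A : measurable A ->
  measurable (f @^-1` A).
Proof. by move=> mA; rewrite -[X in measurable X]setTI; apply: measurable_funP. Qed.

Let pair (om : T) := (p om, w om).
Let mpair : measurable_fun setT pair.
Proof. by apply: measurable_fun_pair; exact: measurable_funP. Qed.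
Let mpairC C : measurable C -> measurable (pair @^-1` C).
Proof. by move=> mC; rewrite -[X in measurable X]setTI; apply: mpair. Qed.

(** The remaining randomness is [T] itself with the coarser sigma-algebra generated by [G]: the
    outcome becomes a third coordinate independent of [(p, w)], and the other variables need not be
    listed. *)
Let T' := g_sigma_algebraType G.
Let toT' (om : T) : T' := om.
Let mtoT' : measurable_fun setT toT'.
Proof.
move=> _ B mB; rewrite setTI.
suff : <<s G >> `<=` measurable by apply.
by apply: smallest_sub => //; exact: sigma_algebra_measurable.
Qed.
#[local] HB.instance Definition _ := isMeasurableFun.Build _ _ _ _ toT' mtoT'.

#[local] HB.instance Definition _ := isMeasurableFun.Build _ _ _ _ pair mpair.

Let P' := distribution P toT'.
Let law := distribution P pair.
Let mu := distribution P p.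
Let gam := distribution P w.

Let pairE C : measurable C -> P (pair @^-1` C) = (mu \x gam) C.
Proof.
move=> mC; apply/esym.
apply: (@product_measure_unique _ _ _ _ R mu gam
  (pushforward_measure P mpair)) => //.
move=> A B mA mB; have := indep mA mB GT.
by rewrite setIT probability_setT mule1.
Qed.

(** Two extensions from pi-systems: first in [E] with the rectangle fixed, then in [C]. *)
Let pair_indep C E : measurable C -> <<s G >> E ->
  P (pair @^-1` C `&` E) = (mu \x gam) C * P E.
Proof.
move=> mC sE; rewrite -pairE // setIC muleC.
pose G2 := preimage_set_system setT pair
  [set A `*` B | A in measurable & B in measurable].
have G2m : G2 `<=` measurable.
  move=> _ [_ [A mA [B mB <-]] <-]; rewrite setTI; apply: mpairC.
  exact: measurableX.
apply: (@independent_g_sigma _ G2) => //.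
- by have := mtoT' measurableT sE; rewrite setTI.
- move=> _ _ [_ [A mA [B mB <-]] <-] [_ [A' mA' [B' mB' <-]] <-].
  exists ((A `&` A') `*` (B `&` B')); first by exists (A `&` A'); [exact: measurableI|exists (B `&` B'); [exact: measurableI|]].
  by rewrite !setTI setXI.
- exists setT; last by rewrite setTI preimage_setT.
  by exists setT => //; exists setT => //; rewrite setXTT.
- move=> _ [_ [A mA [B mB <-]] <-]; rewrite setTI setIC muleC.
  rewrite -[pair @^-1` _]/(p @^-1` A `&` w @^-1` B).
  apply: (@independent_g_sigma _ G) => //; first by apply: measurableI; exact: mpre.
  move=> E' GE'; rewrite indep //; congr (_ * _).
  by have := indep mA mB GT; rewrite setIT probability_setT mule1.
- rewrite g_sigma_preimageE; exists C; last by rewrite setTI.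
  by move: mC; rewrite measurable_prod_measurableType.
Qed.

(** The outcome appears both in [(p om, w om)] and as the last argument, but [f] reads the latter
    only through the sigma-algebra generated by [G]. Hence the joint law is a product and Tonelli
    applies. *)
Lemma integral_independent (f : (measurableTypeR R * measurableTypeR R) * T' -> \bar R) :
  measurable_fun setT f -> (forall z, 0 <= f z) ->
  \int[P]_om f ((p om, w om), om) =
  \int[P']_om \int[mu]_a \int[gam]_b f ((a, b), om).
Proof.
move=> mf f0.
pose Phi (om : T) : (measurableTypeR R * measurableTypeR R) * T' := (pair om, toT' om).
have mPhi : measurable_fun setT Phi by exact: measurable_fun_pair.
transitivity (\int[law \x P']_z f z).
  rewrite -[LHS](@ge0_integral_pushforward _ _ _ _ R Phi mPhi P setT f measurableT mf (fun z _ => f0 z)).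
  apply: eq_measure_integral => C mC _; apply/esym.
  apply: (@product_measure_unique _ _ _ _ R law P'
    (pushforward_measure P mPhi)) => //.
  move=> A E mA sE; rewrite -[RHS]/(P (pair @^-1` A) * P E).
  by rewrite pairE //; exact: pair_indep.
rewrite fubini_tonelli2 //; apply: eq_integral => om _.
have mfom : measurable_fun setT (fun z : measurableTypeR R * measurableTypeR R => f (z, om)).
  exact: (measurable_fun_pair1 om mf).
transitivity (\int[mu \x gam]_z f (z, om)).
  by apply: eq_measure_integral => C mC _; exact: pairE.
exact: (@fubini_tonelli1 _ _ _ _ R mu gam (fun z => f (z, om))).
Qed.

Variables (nu : {measure set (measurableTypeR R) -> \bar R}) (U : \bar R)
  (g : R -> R).
Hypothesis hG : transformation nu U g.
Variable s : R.
Hypothesis s0 : s != 0%R.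
Hypothesis p01 : forall om, (0 <= p om <= 1)%R.
Hypothesis pmirror : mirror_conservative P (p : T -> R).
Hypothesis w_normal : forall B, measurable B -> distribution P w B = normal_prob 0 s B.
Local Notation a := (add_noise nu U g).
Local Open Scope ring_scope.

Variable K : R -> R -> T -> R.
Hypotheses (mK : measurable_fun setT
    (fun z : (measurableTypeR R * measurableTypeR R) * g_sigma_algebraType G =>
       K z.1.1 z.1.2 z.2))
  (K0 : forall q b om, 0 <= K q b om) (K1 : forall q b om, K q b om <= 1)
  (KC : forall q b om, K (1 - q) b om = K q b om).

Let Y := ((measurableTypeR R * measurableTypeR R) * T')%type.

Let ma : measurable_fun setT (fun z : Y => a z.1.1 z.1.2).
Proof.
apply: (measurable_add_noise hG (a := fun z : Y => z.1.1) (b := fun z : Y => z.1.2)).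
- exact: (measurableT_comp measurable_fst measurable_fst).
- exact: (measurableT_comp measurable_snd measurable_fst).
Qed.

Let mKa : measurable_fun setT
  (fun z : Y => K z.1.1 (Num.min (a z.1.1 z.1.2) (1 - a z.1.1 z.1.2)) z.2).
Proof.
apply: (measurableT_comp mK (g := fun z : Y =>
  (((z.1.1, Num.min (a z.1.1 z.1.2) (1 - a z.1.1 z.1.2)), z.2) : Y))).
apply: measurable_fun_pair; last exact: measurable_snd.
apply: measurable_fun_pair.
  exact: (measurableT_comp measurable_fst measurable_fst).
by apply: measurable_minr => //; apply: measurable_funB.
Qed.

Let mind (e : Y -> bool) : measurable_fun setT e -> measurable_fun setT
  (fun z : Y => ((e z)%:R * K z.1.1 (Num.min (a z.1.1 z.1.2) (1 - a z.1.1 z.1.2)) z.2)%:E).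
Proof.
move=> me; apply/measurable_EFinP; apply: measurable_funM => //.
exact: measurable_indicator.
Qed.

Let flow (z : Y) := ((a z.1.1 z.1.2 <= 2^-1)%R%:R *
  K z.1.1 (Num.min (a z.1.1 z.1.2) (1 - a z.1.1 z.1.2)) z.2)%:E.
Let fhigh (z : Y) := ((2^-1 < a z.1.1 z.1.2)%R%:R *
  K z.1.1 (Num.min (a z.1.1 z.1.2) (1 - a z.1.1 z.1.2)) z.2)%:E.
Let mflow : measurable_fun setT flow.
Proof. by apply: mind; exact: measurable_fun_ler. Qed.
Let mfhigh : measurable_fun setT fhigh.
Proof. by apply: mind; exact: measurable_fun_ltr. Qed.
Let flow0 z : (0 <= flow z)%E. Proof. by rewrite lee_fin mulr_ge0. Qed.
Let fhigh0 z : (0 <= fhigh z)%E. Proof. by rewrite lee_fin mulr_ge0. Qed.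

Let mpt (f : Y -> \bar R) : measurable_fun setT f ->
  measurable_fun setT (fun om => f ((p om, w om), toT' om)).
Proof.
move=> mf; apply: (measurableT_comp mf).
exact: (measurable_fun_pair mpair mtoT').
Qed.

Lemma measurable_mirror_low : measurable_fun setT (fun om =>
  ((a (p om) (w om) <= 2^-1)%R%:R *
    K (p om) (Num.min (a (p om) (w om)) (1 - a (p om) (w om))) om)%:E).
Proof. exact: (mpt mflow). Qed.

Lemma measurable_mirror_high : measurable_fun setT (fun om =>
  ((2^-1 < a (p om) (w om))%R%:R *
    K (p om) (Num.min (a (p om) (w om)) (1 - a (p om) (w om))) om)%:E).
Proof. exact: (mpt mfhigh). Qed.

Lemma expectation_mirror :
  (\int[P]_om ((a (p om) (w om) <= 2^-1)%R%:R *
      K (p om) (Num.min (a (p om) (w om)) (1 - a (p om) (w om))) om)%:E <=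
   \int[P]_om ((2^-1 < a (p om) (w om))%R%:R *
      K (p om) (Num.min (a (p om) (w om)) (1 - a (p om) (w om))) om)%:E)%E.
Proof.
have eqle (u v u' v' : \bar R) : u = u' -> v = v' -> (u' <= v')%E -> (u <= v)%E.
  by move=> -> ->.
apply: (eqle _ _ _ _ (integral_independent mflow flow0) (integral_independent mfhigh fhigh0)).
have mint (f : Y -> \bar R) : measurable_fun setT f -> (forall z, 0 <= f z)%E ->
    measurable_fun setT (fun om : T' => \int[mu]_q \int[gam]_b f ((q, b), om))%E.
  move=> mf f0.
  pose f2 (z : T' * (measurableTypeR R * measurableTypeR R)) := f (z.2, z.1).
  have mf2 : measurable_fun setT f2.
    apply: (measurableT_comp mf).
    by apply: measurable_fun_pair; [exact: measurable_snd|exact: measurable_fst].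
  have := measurable_fun_fubini_tonelli_F (m2 := law) f2 mf2 (fun z => f0 _).
  congr (measurable_fun _ _); apply/funext => om; rewrite /fubini_F /f2 /=.
  have mfom : measurable_fun setT (fun z : measurableTypeR R * measurableTypeR R => f (z, om)).
    exact: (measurable_fun_pair1 om mf).
  transitivity (\int[mu \x gam]_z f (z, om))%E.
    by apply: eq_measure_integral => C mC _; exact: pairE.
  exact: (@fubini_tonelli1 _ _ _ _ R mu gam (fun z => f (z, om))).
apply: ge0_le_integral; [exact: measurableT| |exact: mint|exact: mint|].
  by move=> om _; apply: integral_ge0 => q _; apply: integral_ge0 => b _; exact: flow0.
move=> om _.
have gamE (f : measurableTypeR R -> \bar R) :
    (\int[gam]_b f b = \int[normal_prob 0 s]_b f b)%E.
  by apply: eq_measure_integral => B mB _; exact: w_normal.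
have fubE (f : Y -> \bar R) : (\int[mu]_q \int[gam]_b f ((q, b), om) =
    \int[mu]_q \int[normal_prob 0 s]_b f ((q, b), om))%E.
  by apply: eq_integral => q _; exact: gamE.
apply: (eqle _ _ _ _ (fubE _) (fubE _)).
have mu01 : mu (~` `[0, 1]%classic) = 0%E.
  rewrite -[LHS]/(P (p @^-1` (~` `[0, 1]%classic))).
  rewrite (_ : _ @^-1` _ = set0) ?measure0 //.
  by apply/seteqP; split => // o /=; rewrite in_itv /= p01.
have mu_mirror (a1 a2 : R) : 0 <= a1 -> a1 <= a2 -> a2 <= 2^-1 ->
    (mu `[a1, a2]%classic <= mu `[(1 - a2)%R, (1 - a1)%R]%classic)%E.
  move=> h1 h2 h3; have := pmirror h1 h2 h3.
  have E (b1 b2 : R) : [set om | b1 <= p om <= b2] = p @^-1` `[b1, b2]%classic.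
    by apply/seteqP; split => o /=; rewrite in_itv.
  by rewrite !E.
exact: (mirror_integral hG s0 mu01 mu_mirror (measurable_fun_pair1 om mK)
  (fun q b => K0 q b om) (fun q b => K1 q b om) (fun q b => KC q b om)).
Qed.

End independence.

(** * The information that leaves out one null p-value and one noise variable *)

Section rectangles.
Local Open Scope ereal_scope.
Context d (T : measurableType d) (R : realType) (P : probability T R).

(** The condition [E i0 = setT] leaves coordinate [i0] unconstrained: a pi-system for the other
    coordinates, on which mutual independence yields product formulas directly. *)
Definition rectangles {I : finType} (A : {set I}) (F : I -> set (set T)) (i0 : I)
    : set (set T) :=
  [set Q | exists E : I -> set T, [/\ forall i, i \in A -> F i (E i),
    E i0 = setT & Q = \bigcap_(i in [set` A]) E i]].

Variables (I : finType) (A : {set I}) (F : I -> set (set T)) (i0 : I).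
Hypothesis F_T : forall i, F i setT.

Lemma rectangles_setT : rectangles A F i0 setT.
Proof. by exists (fun=> setT); split => //; rewrite bigcapT. Qed.

Lemma rectangles_setI : (forall i, setI_closed (F i)) ->
  setI_closed (rectangles A F i0).
Proof.
move=> FI _ _ [E [FE E0 ->]] [E' [FE' E0' ->]].
exists (fun i => E i `&` E' i); split; last by rewrite bigcapI.
- by move=> i iA; apply: FI; [exact: FE|exact: FE'].
- by rewrite E0 E0' setIT.
Qed.

Lemma rectangles_single i B : i \in A -> i != i0 -> F i B -> rectangles A F i0 B.
Proof.
move=> iA ii0 FB; exists (fun i' => if i' == i then B else setT); split.
- by move=> i' _; case: eqP => [->|].
- by rewrite eq_sym (negbTE ii0).
- apply/seteqP; split => [y Bo i' _|y /(_ i iA)]; last by rewrite eqxx.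
  by case: ifP.
Qed.

Lemma rectangles_cons B Q : i0 \in A -> F i0 B -> rectangles A F i0 Q ->
  exists E : I -> set T, (forall i, i \in A -> F i (E i)) /\
    B `&` Q = \bigcap_(i in [set` A]) E i.
Proof.
move=> i0A FB [E [FE E0 ->]].
exists (fun i => if i == i0 then B else E i); split.
  by move=> i iA; case: eqP => [->//|_]; exact: FE.
apply/seteqP; split => [y [Bo Eo] i iA|y Eo].
  by rewrite /=; case: eqP => [//|_]; exact: Eo.
split; first by have := Eo i0 i0A; rewrite eqxx.
move=> i iA; have := Eo i iA; case: eqP => [->|//].
by rewrite E0.
Qed.

Lemma rectangles_independent B Q : i0 \in A -> mutually_independent P A F ->
  F i0 B -> rectangles A F i0 Q -> P (B `&` Q) = P B * P Q.
Proof.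
move=> i0A indF FB [E [FE E0 ->]].
pose E' i := if i == i0 then B else E i.
have FE' i : i \in A -> F i (E' i).
  by move=> iA; rewrite /E'; case: eqP => [->//|_]; exact: FE.
have -> : B `&` \bigcap_(i in [set` A]) E i = \bigcap_(i in [set` A]) E' i.
  apply/seteqP; split => [y [Bo Eo] i iA|y Eo].
    by rewrite /E'; case: eqP => [//|_]; exact: Eo.
  split; first by have := Eo i0 i0A; rewrite /E' eqxx.
  move=> i iA; have := Eo i iA; rewrite /E'; case: eqP => [->|//].
  by rewrite E0.
rewrite (indF A E') ?subxx // (indF A E) ?subxx //.
rewrite (bigD1 i0) //= [in RHS](bigD1 i0) //= {1}/E' eqxx E0 probability_setT mul1e.
congr (_ * _); apply: eq_bigr => i /andP[_ ii0].
by rewrite /E' (negbTE ii0).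
Qed.

End rectangles.

Section leave_out.
Local Open Scope ereal_scope.
Context d dD (T : measurableType d) (Data : measurableType dD) (R : realType)
  (P : probability T R).
Variables (S : T -> Data) (mS : measurable_fun setT S).
Variables (I K : finType) (p : I -> Data -> R) (N : K -> T -> R) (H0 : {set I}).
Hypotheses (mp : forall i, measurable_fun setT (p i))
  (mN : forall k, measurable_fun setT (N k)).
Hypothesis null_indep : mutually_independent P H0 (fun i => sigma_of (p i \o S)).
Hypothesis null_nonnull_indep : independent P
  (sigma_family H0 (fun i => p i \o S))
  (sigma_family (~: H0)%SET (fun i => p i \o S)).
Hypothesis noise_indep : mutually_independent P [set: K]%SET (fun k => sigma_of (N k)).
Hypothesis noise_data_indep : independent P (sigma_of S) (sigma_family [set: K]%SET N).
Variables (i0 : I) (k0 : K).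
Hypothesis i0H0 : i0 \in H0.

Lemma sigma_of_setT d1 d2 (T1 : measurableType d1) (T2 : measurableType d2)
    (Y : T1 -> T2) : sigma_of Y setT.
Proof. by exists setT => //; rewrite setTI. Qed.

Lemma sigma_of_setI d1 d2 (T1 : measurableType d1) (T2 : measurableType d2)
    (Y : T1 -> T2) : setI_closed (sigma_of Y).
Proof.
move=> _ _ [B mB <-] [B' mB' <-]; exists (B `&` B'); first exact: measurableI.
by rewrite !setTI.
Qed.

Let smeas d1 d2 (T1 : measurableType d1) (T2 : measurableType d2)
    (Y : T1 -> T2) : measurable_fun setT Y -> sigma_of Y `<=` measurable.
Proof. by move=> mY _ [B mB <-]; exact: mY. Qed.

Let s_data i : sigma_of (p i \o S) `<=` sigma_of S.
Proof.
move=> _ [B mB <-]; exists (p i @^-1` B); last by rewrite !setTI comp_preimage.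
by rewrite -[X in measurable X]setTI; exact: mp.
Qed.

Let sigma_of_bigcap (J : finType) (A : {set J}) d2 (T2 : measurableType d2)
    (Y : T -> T2) (E : J -> set T) : (forall j, j \in A -> sigma_of Y (E j)) ->
  sigma_of Y (\bigcap_(j in [set` A]) E j).
Proof.
move=> YE; rewrite (_ : \bigcap_(j in [set` A]) E j =
    \big[setI/setT]_(j <- enum A) E j); last first.
  rewrite (_ : [set` A] = [set` enum A]) ?bigcap_seq //.
  by apply/seteqP; split => j /=; rewrite mem_enum.
rewrite big_seq; elim/big_ind : _ => [||j]; first exact: sigma_of_setT.
  exact: sigma_of_setI.
by rewrite mem_enum; exact: YE.
Qed.

Let fam_bigcap (J : finType) (A : {set J}) (Y : J -> T -> R) (E : J -> set T) :
  (forall j, j \in A -> sigma_of (Y j) (E j)) ->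
  sigma_family A Y (\bigcap_(j in [set` A]) E j).
Proof.
move=> YE; rewrite (_ : \bigcap_(j in [set` A]) E j =
    \big[setI/setT]_(j <- enum A) E j); last first.
  rewrite (_ : [set` A] = [set` enum A]) ?bigcap_seq //.
  by apply/seteqP; split => j /=; rewrite mem_enum.
rewrite big_seq; elim/big_ind : _ => [|B B' sB sB'|j].
- by rewrite -(setD0 setT); apply: sigma_algebraCD; exact: sigma_algebra0.
- exact: (@measurableI _ (g_sigma_algebraType _) _ _ sB sB').
- by rewrite mem_enum => jA; apply: sub_sigma_algebra; exists j => //; exact: YE.
Qed.

Let fam_data : sigma_family (~: H0)%SET (fun i => p i \o S) `<=` sigma_of S.
Proof.
apply: smallest_sub; last by move=> E [i _]; exact: s_data.
exact/sigma_algebra_preimage/sigma_algebra_measurable.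
Qed.

Let Rp := rectangles H0 (fun i => sigma_of (p i \o S)) i0.
Let Rn := rectangles [set: K]%SET (fun k => sigma_of (N k)) k0.

(* A pi-system generating the information carried by all p-values but the one
   of [i0] and all noise variables but the one of index [k0]. *)
Definition leave_out : set (set T) :=
  [set Q | exists E1 E2 E3,
    [/\ rectangles H0 (fun i => sigma_of (p i \o S)) i0 E1,
        sigma_family (~: H0)%SET (fun i => p i \o S) E2,
        rectangles [set: K]%SET (fun k => sigma_of (N k)) k0 E3 &
        Q = E1 `&` E2 `&` E3]].

Let fam_setT : sigma_family (~: H0)%SET (fun i => p i \o S) setT.
Proof. by rewrite -(setD0 setT); apply: sigma_algebraCD; exact: sigma_algebra0. Qed.

Lemma leave_out_setT : leave_out setT.
Proof.
exists setT, setT, setT; split => //; last by rewrite !setTI.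
- by apply: rectangles_setT => i; exact: sigma_of_setT.
- by apply: rectangles_setT => i; exact: sigma_of_setT.
Qed.

Lemma leave_out_setI : setI_closed leave_out.
Proof.
move=> _ _ [E1 [E2 [E3 [r1 s2 r3 ->]]]] [E1' [E2' [E3' [r1' s2' r3' ->]]]].
exists (E1 `&` E1'), (E2 `&` E2'), (E3 `&` E3'); split.
- by apply: rectangles_setI => // i; exact: sigma_of_setI.
- exact: (@measurableI _ (g_sigma_algebraType _) _ _ s2 s2').
- by apply: rectangles_setI => // i; exact: sigma_of_setI.
- by rewrite setIACA (setIACA E1).
Qed.

Let Rp_data E : Rp E -> sigma_of S E.
Proof.
by move=> [E' [FE _ ->]]; apply: sigma_of_bigcap => i iH; apply: s_data; exact: FE.
Qed.

Let Rn_fam E : Rn E -> sigma_family [set: K]%SET N E.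
Proof. by move=> [E' [FE _ ->]]; exact: fam_bigcap. Qed.

Let fam_meas : sigma_family [set: K]%SET N `<=` measurable.
Proof.
apply: smallest_sub; first exact: sigma_algebra_measurable.
by move=> E [k _]; exact: smeas.
Qed.

Lemma leave_out_measurable : leave_out `<=` measurable.
Proof.
move=> _ [E1 [E2 [E3 [r1 s2 r3 ->]]]]; apply: measurableI; first apply: measurableI.
- exact: (smeas mS (Rp_data r1)).
- exact: (smeas mS (fam_data s2)).
- exact: (fam_meas (Rn_fam r3)).
Qed.

(** The factors are regrouped as data against noise, then nulls against non-nulls; within each
    mutually independent family the left-out coordinate is split off by [rectangles_independent]. *)
Lemma leave_out_independent (A B : set R) E :
  measurable A -> measurable B -> leave_out E ->
  P (((p i0 \o S) @^-1` A `&` N k0 @^-1` B) `&` E) =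
  P ((p i0 \o S) @^-1` A) * P (N k0 @^-1` B) * P E.
Proof.
move=> mA mB [E1 [E2 [E3 [r1 s2 r3 ->]]]].
have sA : sigma_of (p i0 \o S) ((p i0 \o S) @^-1` A) by exists A => //; rewrite setTI.
have sB : sigma_of (N k0) (N k0 @^-1` B) by exists B => //; rewrite setTI.
have AE1 : sigma_family H0 (fun i => p i \o S) ((p i0 \o S) @^-1` A `&` E1).
  have [E' [FE ->]] := rectangles_cons i0H0 sA r1; exact: fam_bigcap.
have E1s : sigma_family H0 (fun i => p i \o S) E1.
  by case: r1 => [E' [FE _ ->]]; exact: fam_bigcap.
have BE3 : sigma_family [set: K]%SET N (N k0 @^-1` B `&` E3).
  by have [E' [FE ->]] := rectangles_cons (finset.in_setT k0) sB r3; exact: fam_bigcap.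
have E3s := Rn_fam r3; have E1d := Rp_data r1; have E2d := fam_data s2.
have AE1d : sigma_of S ((p i0 \o S) @^-1` A `&` E1).
  by apply: sigma_of_setI => //; exact: s_data sA.
have -> : (p i0 \o S) @^-1` A `&` N k0 @^-1` B `&` (E1 `&` E2 `&` E3) =
    ((p i0 \o S) @^-1` A `&` E1 `&` E2) `&` (N k0 @^-1` B `&` E3).
  by apply/seteqP; split => o /=; tauto.
rewrite (noise_data_indep (sigma_of_setI AE1d E2d) BE3).
rewrite (null_nonnull_indep AE1 s2) (rectangles_independent _ null_indep sA r1) //.
rewrite (rectangles_independent (finset.in_setT _) noise_indep sB r3).
rewrite (noise_data_indep (sigma_of_setI E1d E2d) E3s) (null_nonnull_indep E1s s2).
by rewrite -!muleA; congr (_ * _); rewrite [RHS]muleCA; congr (_ * _); rewrite [RHS]muleCA.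
Qed.

Lemma measurable_leave_out_p i : i != i0 ->
  measurable_fun [set: g_sigma_algebraType leave_out] (p i \o S : _ -> R).
Proof.
move=> ii0 _ B mB; apply: sub_sigma_algebra.
have sB : sigma_of (p i \o S) ([set: T] `&` (p i \o S) @^-1` B) by exists B.
have [iH|iH] := boolP (i \in H0).
- exists ([set: T] `&` (p i \o S) @^-1` B), setT, setT; split => //; last by rewrite !setIT.
  + by apply: rectangles_single sB => // j; exact: sigma_of_setT.
  + by apply: rectangles_setT => j; exact: sigma_of_setT.
- exists setT, ([set: T] `&` (p i \o S) @^-1` B), setT; split => //; last by rewrite setTI setIT.
  + by apply: rectangles_setT => j; exact: sigma_of_setT.
  + by apply: sub_sigma_algebra; exists i => //=; rewrite inE.
  + by apply: rectangles_setT => j; exact: sigma_of_setT.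
Qed.

Lemma measurable_leave_out_noise k : k != k0 ->
  measurable_fun [set: g_sigma_algebraType leave_out] (N k : _ -> R).
Proof.
move=> kk0 _ B mB; apply: sub_sigma_algebra.
have sB : sigma_of (N k) ([set: T] `&` N k @^-1` B) by exists B.
exists setT, setT, ([set: T] `&` N k @^-1` B); split => //; last by rewrite !setTI.
- by apply: rectangles_setT => j; exact: sigma_of_setT.
- by apply: rectangles_single sB => // j; exact: sigma_of_setT.
Qed.

End leave_out.

(** * Measurability *)

Section finite_valued.
Context d (Y : measurableType d).

(** Measurability by fibres requires no sigma-algebra on the target; random indices and random sets
    of rounds are handled in this form. *)
Definition fin_measurable {V : finType} (f : Y -> V) : Prop :=
  forall v, measurable [set y | f y = v].

Lemma fin_measurable_pred (V : finType) (f : Y -> V) (D : set V) :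
  fin_measurable f -> measurable (f @^-1` D).
Proof.
move=> mf; rewrite (_ : f @^-1` D = \bigcup_(v in D) [set y | f y = v]).
  by apply: fin_bigcup_measurable => // v _; exact: mf.
by apply/seteqP; split => [y Dy|y [v Dv fy]]; [exists (f y)|rewrite /= fy].
Qed.

Lemma fin_measurable_measurable (V : finType) (f : Y -> V) d'
    (Y' : measurableType d') (F : V -> Y') :
  fin_measurable f -> measurable_fun setT (F \o f).
Proof. by move=> mf _ B mB; rewrite setTI; exact: (fin_measurable_pred (F @^-1` B) mf). Qed.

Lemma fin_measurable_comp (V W : finType) (f : Y -> V) (F : V -> Y -> W) :
  fin_measurable f -> (forall v, fin_measurable (F v)) ->
  fin_measurable (fun y => F (f y) y).
Proof.
move=> mf mF w.
rewrite (_ : [set y | _] = \bigcup_(v in setT) ([set y | f y = v] `&` [set y | F v y = w])).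
  apply: fin_bigcup_measurable => // v _; apply: measurableI; first exact: mf.
  exact: mF.
by apply/seteqP; split => [y By|y [v _ [/= <-]]] //; exists (f y).
Qed.

Lemma fin_measurable_cst (V : finType) (v : V) : fin_measurable (fun _ => v).
Proof.
move=> v'; have [<-|vv'] := eqVneq v v'.
  by rewrite (_ : [set y | _] = setT) //; apply/seteqP; split.
by rewrite (_ : [set y | _] = set0) //; apply/seteqP; split => // y /= /eqP; rewrite (negbTE vv').
Qed.

Lemma fin_measurable_app (V W : finType) (f : Y -> V) (F : V -> W) :
  fin_measurable f -> fin_measurable (F \o f).
Proof.
by move=> mf; apply: (fin_measurable_comp (F := fun v _ => F v) mf) => v;
  exact: fin_measurable_cst.
Qed.

Lemma fin_measurable_bool (b : Y -> bool) :
  measurable_fun setT b <-> fin_measurable b.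
Proof.
split=> [mb v|mb _ B mB]; last by rewrite setTI; exact: fin_measurable_pred.
by rewrite -[X in measurable X]setTI; exact: (mb measurableT [set v]).
Qed.

Lemma fin_measurable_set (V : finType) (b : V -> Y -> bool) :
  (forall v, measurable_fun setT (b v)) ->
  fin_measurable (fun y => [set v | b v y]%SET).
Proof.
move=> mb A; rewrite (_ : [set y | _] = \bigcap_(v in setT) [set y | b v y = (v \in A)]).
  by apply: fin_bigcap_measurable => // v _; exact: ((fin_measurable_bool _).1 (mb v)).
apply/seteqP; split => [y /= <- v _|y bA]; first by rewrite /= inE.
by apply/setP => v; rewrite inE; exact: bA.
Qed.

Lemma measurable_forall_in (V : finType) (A : {set V}) (b : V -> Y -> bool) :
  (forall v, measurable_fun setT (b v)) ->
  measurable_fun setT (fun y => [forall v in A, b v y]).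
Proof.
move=> mb; rewrite (_ : (fun y => _) = (fun y => A \subset [set v | b v y]%SET)).
  apply/fin_measurable_bool.
  exact: (fin_measurable_app (fun B : {set V} => A \subset B) (fin_measurable_set mb)).
apply/funext => y; apply/forall_inP/fintype.subsetP => h v vA.
  by rewrite inE h.
by have := h v vA; rewrite inE.
Qed.

End finite_valued.

Section selection.
Context {R : realType}.
Variables (nu : {measure set (measurableTypeR R) -> \bar R}) (U : \bar R)
  (g : R -> R).
Hypothesis hG : transformation nu U g.
Context d (Y : measurableType d).
Variables (n m : nat) (tie : {set 'I_n} -> 'I_n)
  (p : Y -> 'I_n -> R) (z : Y -> nat -> 'I_n -> R).
Hypotheses (mp : forall i, measurable_fun setT (fun y => p y i))
  (mz : forall (j : nat) i, (j < m)%N -> measurable_fun setT (fun y => z y j i)).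

Lemma fin_measurable_report (j : nat) (A : {set 'I_n}) : (j < m)%N ->
  fin_measurable (fun y => report_noisy_min nu U g tie A (mirrored (p y)) (z y j)).
Proof.
move=> jm; rewrite /report_noisy_min.
have mnoisy i : measurable_fun setT
    (fun y => add_noise nu U g (mirrored (p y) i) (z y j i)).
  apply: (measurable_add_noise hG); last exact: mz.
  by apply: measurable_minr => //; apply: measurable_funB.
apply: (fin_measurable_app tie); apply: fin_measurable_set => i.
apply: measurable_and => //.
by apply: measurable_forall_in => k; exact: measurable_fun_ler.
Qed.

Lemma fin_measurable_remaining (j : nat) : (j <= m)%N ->
  fin_measurable (fun y => remaining nu U g tie (p y) (z y) j).
Proof.
elim: j => [_|j IH jm] /=; first exact: fin_measurable_cst.
apply: (fin_measurable_comp (F := fun A y =>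
  (A :\ report_noisy_min nu U g tie A (mirrored (p y)) (z y j))%SET)).
  exact/IH/ltnW.
move=> A; apply: (fin_measurable_app (fun i => (A :\ i)%SET)).
exact: fin_measurable_report.
Qed.

Lemma fin_measurable_selected (j : nat) : (j < m)%N ->
  fin_measurable (fun y => selected nu U g tie (p y) (z y) j).
Proof.
move=> jm; rewrite /selected.
apply: (fin_measurable_comp (F := fun A y =>
  report_noisy_min nu U g tie A (mirrored (p y)) (z y j))).
  exact/fin_measurable_remaining/ltnW.
by move=> A; exact: fin_measurable_report.
Qed.

End selection.

Section thresholds.
Context {R : realType} {dX d : measure_display}.
Context {X : measurableType dX} {Y : measurableType d}.
Variables (n m : nat) (x : 'I_n -> X) (idx : nat -> 'I_n) (s0 : X -> R)
  (update : nat -> @observation R X m -> (X -> R) -> X -> R).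
Hypothesis update_measurable : forall t y (o : Y -> @observation R X m) (s : Y -> X -> R),
  measurable_fun setT o -> measurable_fun setT (s ^~ y) ->
  measurable_fun setT (fun v => update t (o v) (s v) y).
Variable pt : Y -> nat -> R.
Hypothesis mpt : forall j : 'I_m, measurable_fun setT (fun y => pt y j).

Let thr t (v : Y) := threshold x idx (pt v) s0 update t.

Lemma fin_measurable_mirror_set (s : Y -> X -> R) :
  (forall y, measurable_fun setT (s ^~ y)) ->
  fin_measurable (fun v => [set j : 'I_m | 1 - s v (x (idx j)) <= pt v j]%SET).
Proof.
move=> ms; apply: fin_measurable_set => j; apply: measurable_fun_ler => //.
exact: measurable_funB.
Qed.

Lemma fin_measurable_rejection_set (s : Y -> X -> R) :
  (forall y, measurable_fun setT (s ^~ y)) ->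
  fin_measurable (fun v => [set j : 'I_m | pt v j <= s v (x (idx j))]%SET).
Proof. by move=> ms; apply: fin_measurable_set => j; apply: measurable_fun_ler. Qed.

Lemma measurable_observed (s : Y -> X -> R) :
  (forall y, measurable_fun setT (s ^~ y)) ->
  measurable_fun setT (fun v => observed m x idx (pt v) (s v)).
Proof.
move=> ms; rewrite /observed; apply: measurable_fun_pair; last apply: measurable_fun_pair.
- apply/measurable_fun_tnthP => j.
  rewrite (_ : _ \o _ = (fun v => (x (idx j), partially_masked x idx (pt v) (s v) j))); last first.
    by apply/funext => v /=; rewrite tnth_mktuple.
  apply: measurable_fun_pair => //; rewrite /partially_masked.
  apply: measurable_fun_ifT.
  + apply: measurable_and; apply: measurable_fun_ltr => //.
    exact: measurable_funB.
  + by apply: measurable_fun_pair.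
  + apply: measurable_fun_pair => //; apply: measurable_minr => //.
    exact: measurable_funB.
- exact: (fin_measurable_measurable (fun A : {set 'I_m} => #|A|)
    (fin_measurable_mirror_set ms)).
- exact: (fin_measurable_measurable (fun A : {set 'I_m} => #|A|)
    (fin_measurable_rejection_set ms)).
Qed.

(** Thresholds are random functions on [X]; measurability is kept pointwise in [y], so that the
    function space carries no sigma-algebra. *)
Lemma measurable_threshold t y : measurable_fun setT (fun v => thr t v y).
Proof.
elim: t y => [|t IH] y; first exact: measurable_cst.
by apply: update_measurable; [exact: measurable_observed|exact: IH].
Qed.

Lemma measurable_fdr_hat_le alpha t :
  measurable_fun setT (fun v => fdr_hat x idx (pt v) s0 update t <= alpha).
Proof.
apply/fin_measurable_bool.
pose F (A B : {set 'I_m}) : bool := (1 + #|A|)%:R / (maxn #|B| 1)%:R <= alpha.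
have mA := fin_measurable_mirror_set (measurable_threshold t).
have mB := fin_measurable_rejection_set (measurable_threshold t).
apply: (fin_measurable_comp (F := fun A v => F A [set j : 'I_m | pt v j <= thr t v (x (idx j))]%SET) mA).
by move=> A; exact: (fin_measurable_app (F A) mB).
Qed.

Lemma measurable_stops_first alpha t :
  measurable_fun setT (fun v => stops_first x s0 update alpha idx (pt v) t).
Proof.
apply: measurable_and; first exact: measurable_fdr_hat_le.
rewrite (_ : (fun v => _) = (fun v => [forall t' in [set: 'I_t]%SET,
    ~~ (fdr_hat x idx (pt v) s0 update t' <= alpha)])).
  apply: measurable_forall_in => t'; apply: measurable_neg.
  exact: measurable_fdr_hat_le.
by apply/funext => v; apply: eq_forallb => t'; rewrite inE.
Qed.

Lemma measurable_loo_weight_at J (j : 'I_m) t :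
  measurable_fun setT (fun v => loo_weight_at x s0 update idx J j (pt v) t).
Proof.
have mf : fin_measurable (fun v =>
    [set k in J | (k != j) && (1 - thr t v (x (idx k)) <= pt v k)]%SET).
  rewrite (_ : (fun y => _) = (fun v => J :&: [set k | k != j] :&:
    [set k : 'I_m | 1 - thr t v (x (idx k)) <= pt v k])%SET); last first.
    by apply/funext => v; apply/setP => k; rewrite !inE andbA.
  apply: (fin_measurable_app (fun A => J :&: [set k | k != j] :&: A)%SET).
  exact: fin_measurable_mirror_set (measurable_threshold t).
have mle : measurable_fun setT (fun v => pt v j <= thr t v (x (idx j))).
  by apply: measurable_fun_ler => //; exact: measurable_threshold.
rewrite /loo_weight_at; apply: (measurable_fun_ifT mle) => //.
exact: (fin_measurable_measurable (fun A : {set 'I_m} => (1 + #|A|)%:R^-1 : R) mf).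
Qed.

Lemma measurable_loo_weight alpha J (j : 'I_m) :
  measurable_fun setT (fun v => loo_weight x s0 update alpha idx J j (pt v)).
Proof.
(* A countable partition by stopping time: index 0 is the event of never stopping, index [t.+1] that
   of stopping at [t]. *)
pose E (k : nat) : set Y := if k is t.+1
  then [set v | stops_first x s0 update alpha idx (pt v) t]
  else \bigcap_t [set v | ~~ stops_first x s0 update alpha idx (pt v) t].
have mE k : measurable (E k).
  have ms t (b : bool) : measurable [set v | stops_first x s0 update alpha idx (pt v) t = b].
    by have /fin_measurable_bool := measurable_stops_first alpha t; apply.
  case: k => [|t]; last exact: ms.
  apply: bigcapT_measurable => t; rewrite (_ : [set v | _] =
    [set v | stops_first x s0 update alpha idx (pt v) t = false]) //.
  by apply/seteqP; split => [v /= /negbTE|v /= ->].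
have -> : [set: Y] = \bigcup_k E k.
  apply/seteqP; split => // v _.
  have [[t st]|ns] := pselect (exists t, stops_first x s0 update alpha idx (pt v) t).
    by exists t.+1.
  by exists 0%N => // t _; apply/negP => st; apply: ns; exists t.
apply/(measurable_fun_bigcup _ mE) => -[|t].
- have : measurable_fun (E 0%N) (cst (0 : R) : Y -> R) by exact: measurable_cst.
  apply: eq_measurable_fun => v; rewrite inE => ns.
  by rewrite loo_weight_never // => t; exact: ns.
- have : measurable_fun (E t.+1) (fun v => loo_weight_at x s0 update idx J j (pt v) t).
    exact/measurable_funTS/measurable_loo_weight_at.
  apply: eq_measurable_fun => v; rewrite inE => st.
  by rewrite (loo_weight_stops _ _ st).
Qed.

End thresholds.

Section doob_dynkin.
Context {R : realType} {d dO : measure_display}.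
Context {T : measurableType d} {O : measurableType dO}.

(** Each sublevel set of [f] at a rational [q] is the preimage under [o] of some [E q]; the factor
    sends [v] to the infimum of the [q] with [v] in [E q]. Off the range of [o] this infimum may be
    infinite, and [fine] merely assigns a value. *)
Lemma doob_dynkin (f : T -> R) (o : T -> O) :
  (forall B, measurable B -> sigma_of o [set om | B (f om)]) ->
  exists2 phi : O -> R, measurable_fun setT phi & forall om, phi (o om) = f om.
Proof.
move=> fo.
have ex (q : rat) : exists E : set O, measurable E /\
    forall om, E (o om) <-> f om <= ratr q.
  have [|E mE] := fo `]-oo, ratr q]%classic; first exact: measurable_itv.
  rewrite setTI => eE; exists E; split => // om.
  by rewrite -[E (o om)]/((o @^-1` E) om) eE /= in_itv.
have {ex} /choice[E EP] := ex.
pose psi (v : O) : \bar R := ereal_inf [set (ratr q)%:E | q in [set q | E q v]].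
exists (fine \o psi); last first.
  move=> om; rewrite /= (_ : psi (o om) = (f om)%:E) //.
  apply/eqP; rewrite eq_le; apply/andP; split.
    apply/lee_addgt0Pr => e e0.
    have /rat_in_itvoo[q] : f om < f om + e by rewrite ltrDl.
    rewrite in_itv /= => /andP[q1 q2].
    apply: (@le_trans _ _ (ratr q)%:E); last by rewrite -EFinD lee_fin ltW.
    by apply: ereal_inf_lbound; exists q => //=; apply/(EP q).2; exact: ltW.
  apply/ereal_infP => _ [q /= /(EP q).2 fq <-].
  by rewrite lee_fin.
apply: (measurableT_comp (f := fine)) => //.
move=> mD; apply: (measurability _ (ErealGenInftyO.measurableE R)) => //.
move=> _ [_ [r ->] <-]; rewrite setTI.
rewrite (_ : _ @^-1` _ = \bigcup_(q : rat) (if ratr q < r then E q else set0)).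
  by apply: bigcupT_measurable_rat => q; case: ifP => // _; exact: (EP q).1.
apply/seteqP; split => v /=.
  rewrite in_itv /= => /ereal_inf_ltP[_ [q /= Eq <-]]; rewrite lte_fin => qr.
  by exists q => //; rewrite qr.
move=> [q _]; case: ifP => // qr Eq; rewrite in_itv /=.
apply: (@le_lt_trans _ _ (ratr q)%:E); last by rewrite lte_fin.
by apply: ereal_inf_lbound; exists q.
Qed.

End doob_dynkin.

(** * Mirroring one round of peeling *)

Section peeling_facts.
Context {R : realType}.
Variables (nu : {measure set (measurableTypeR R) -> \bar R}) (U : \bar R)
  (g : R -> R).
Variables (n : nat) (tie : {set 'I_n} -> 'I_n).

Lemma remaining_mirrored (p p' : 'I_n -> R) z j : mirrored p = mirrored p' ->
  remaining nu U g tie p z j = remaining nu U g tie p' z j.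
Proof. by move=> e; elim: j => [|j IH]; [|rewrite /= IH e]. Qed.

Lemma selected_mirrored (p p' : 'I_n -> R) z j : mirrored p = mirrored p' ->
  selected nu U g tie p z j = selected nu U g tie p' z j.
Proof. by move=> e; rewrite /selected (remaining_mirrored z j e) e. Qed.

Hypothesis htie : tie_breaking tie.
Variables (p : 'I_n -> R) (z : nat -> 'I_n -> R).

Lemma report_noisy_min_in (A : {set 'I_n}) (q w : 'I_n -> R) :
  A != finset.set0 -> report_noisy_min nu U g tie A q w \in A.
Proof.
move=> /set0Pn[i0 i0A]; rewrite /report_noisy_min.
set B := [set i in A | _]%SET.
suff /htie : B != finset.set0 by rewrite inE => /andP[].
apply/set0Pn.
have [i iA imin] := @Order.TotalTheory.arg_minP _ _ 'I_n i0 (mem A)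
  (fun i => add_noise nu U g (q i) (w i)) i0A.
exists i; rewrite inE; apply/andP; split => //.
by apply/forall_inP => k kA; exact: imin.
Qed.

Lemma card_remaining j : (j <= n)%N -> #|remaining nu U g tie p z j| = (n - j)%N.
Proof.
elim: j => [_|j IH jn] /=; first by rewrite cardsT card_ord subn0.
have cj := IH (ltnW jn).
have ne : remaining nu U g tie p z j != finset.set0.
  by rewrite -card_gt0 cj subn_gt0.
have := cardsD1 (report_noisy_min nu U g tie (remaining nu U g tie p z j) (mirrored p) (z j))
  (remaining nu U g tie p z j).
by rewrite report_noisy_min_in // cj add1n => e; rewrite subnS e.
Qed.

Lemma selected_in j : (j < n)%N ->
  selected nu U g tie p z j \in remaining nu U g tie p z j.
Proof.
move=> jn; apply: report_noisy_min_in.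
by rewrite -card_gt0 card_remaining ?subn_gt0 // ltnW.
Qed.

Lemma selected_notin j k : (j < k)%N ->
  selected nu U g tie p z j \notin remaining nu U g tie p z k.
Proof.
elim: k => // k IH; rewrite ltnS leq_eqVlt => /orP[/eqP <-|/IH h] /=.
  by rewrite !inE eqxx.
by rewrite in_setD1 (negbTE h) andbF.
Qed.

Lemma selected_inj m : (m <= n)%N ->
  injective (fun j : 'I_m => selected nu U g tie p z j).
Proof.
move=> mn j k e; apply/val_inj; case: (ltngtP j k) => //= lt.
- have := selected_notin lt; rewrite e selected_in //.
  exact: leq_trans (ltn_ord k) mn.
- have := selected_notin lt; rewrite -e selected_in //.
  exact: leq_trans (ltn_ord j) mn.
Qed.

End peeling_facts.

Section selection_mirror.
Context {R : realType}.
Variables (nu : {measure set (measurableTypeR R) -> \bar R}) (U : \bar R)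
  (g : R -> R).
Hypothesis hG : transformation nu U g.
Context {d dD dX : measure_display} {T : measurableType d}.
Variables (P : probability T R) (Data : measurableType dD) (S : T -> Data).
Hypothesis mS : measurable_fun setT S.
Context {X : measurableType dX}.
Variables (n m : nat) (x : 'I_n -> X) (p : 'I_n -> Data -> R) (H0 : {set 'I_n}).
Hypotheses (mp : forall i, measurable_fun setT (p i))
  (p01 : forall i D, 0 <= p i D <= 1).
Hypothesis null_indep : mutually_independent P H0 (fun i => sigma_of (p i \o S)).
Hypothesis null_nonnull_indep : independent P
  (sigma_family H0 (fun i => p i \o S))
  (sigma_family (~: H0)%SET (fun i => p i \o S)).
Hypothesis null_mirror : forall i, i \in H0 -> mirror_conservative P (p i \o S).
Variables (tie : {set 'I_n} -> 'I_n) (Z : nat -> 'I_n -> T -> R) (W : nat -> T -> R).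
Let K := (('I_m * 'I_n) + 'I_m)%type.
Hypothesis mN : forall k : K, measurable_fun setT (noise Z W k).
Variable s : R.
Hypothesis s0 : s != 0.
Hypothesis W_normal : forall (j : 'I_m) (B : set (measurableTypeR R)), measurable B ->
  P (W j @^-1` B) = normal_prob 0 s B.
Hypothesis noise_indep : mutually_independent P [set: K]%SET
  (fun k => sigma_of (noise Z W k)).
Hypothesis noise_data_indep : independent P (sigma_of S)
  (sigma_family [set: K]%SET (noise Z W)).
Variables (th0 : X -> R)
  (update : nat -> @observation R X m -> (X -> R) -> X -> R) (alpha : R).
Hypothesis update_measurable : forall dY (Y : measurableType dY) t y
  (o : Y -> @observation R X m) (th : Y -> X -> R),
  measurable_fun setT o -> measurable_fun setT (th ^~ y) ->
  measurable_fun setT (fun v => update t (o v) (th v) y).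
Local Notation idx := (dp_index nu U g tie (fun i => p i \o S) Z).
Local Notation pv := (dp_pvalue nu U g tie (fun i => p i \o S) Z W).
Local Notation loo := (loo_weight x th0 update alpha).

(** On the event that the selection is [sg], all released values but that of round [j] are
    determined by p-values other than that of [sg j] and noise other than [W j]. This puts the
    integrand in the form required by [expectation_mirror]. *)
Lemma selection_mirror (sg : 'I_m -> 'I_n) (J : {set 'I_m}) (j : 'I_m) :
  injective sg -> sg j \in H0 ->
  let L (e : R -> bool) om := ((([forall k : 'I_m, idx om k == sg k] &&
    e (pv om j))%:R * loo (idx om) J j (fold_at j (pv om)))%:E) in
  [/\ measurable_fun setT (L (fun b => b <= 2^-1)),
      measurable_fun setT (L (fun b => 2^-1 < b)) &
      (\int[P]_om L (fun b => b <= 2^-1)%R om <= \int[P]_om L (fun b => 2^-1 < b)%R om)%E].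
Proof.
move=> sg_inj jH0 L; pose i0 := sg j; pose k0 : K := inr j.
(* Extension of [sg] to all of [nat]; the default [i0] is never read. *)
pose sg' (k : nat) : 'I_n := if insub k is Some k' then sg k' else i0.
have sg'E (k : 'I_m) : sg' k = sg k.
  by rewrite /sg'; case: insubP => [k' _ /val_inj -> //|]; rewrite ltn_ord.
pose G := leave_out S p (noise Z W) H0 i0 k0.
pose T' := g_sigma_algebraType G.
have mP i : i != i0 -> measurable_fun [set: T'] (p i \o S : _ -> R).
  by move=> ii0; exact: measurable_leave_out_p.
have mNs k : k != k0 -> measurable_fun [set: T'] (noise Z W k : _ -> R).
  by move=> kk0; exact: measurable_leave_out_noise.
(* The p-value [i0] and the noise released in round [j] become free variables
   [q] and [b]; the selection only sees [min(q, 1 - q)]. *)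
pose PP (q : R) (om : T) (k : 'I_n) := if k == i0 then q else p k (S om).
pose sel q om (k : nat) := selected nu U g tie (PP q om) (fun j i => Z j i om) k.
pose pts (b : R) (om : T) (k : nat) :=
  if k == j then b else add_noise nu U g (p (sg' k) (S om)) (W k om).
pose Kf (q b : R) (om : T) : R :=
  [forall k : 'I_m, sel q om k == sg k]%:R * loo sg' J j (pts b om).
pose Y := ((measurableTypeR R * measurableTypeR R) * T')%type.
have mq : measurable_fun [set: Y] (fun z : Y => z.1.1 : R).
  exact: (measurableT_comp measurable_fst measurable_fst).
have mb : measurable_fun [set: Y] (fun z : Y => z.1.2 : R).
  exact: (measurableT_comp measurable_snd measurable_fst).
have mom (f : T -> R) : measurable_fun [set: T'] (f : T' -> R) ->
    measurable_fun [set: Y] (fun z : Y => f z.2).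
  by move=> mf; exact: (measurableT_comp mf measurable_snd).
have mKf : measurable_fun [set: Y] (fun z : Y => Kf z.1.1 z.1.2 z.2).
  apply: measurable_funM.
    have mall : measurable_fun [set: Y]
        (fun z : Y => [forall k : 'I_m, sel z.1.1 z.2 k == sg k]).
      rewrite (_ : (fun z => _) = (fun z : Y => [forall k in [set: 'I_m]%SET,
          sel z.1.1 z.2 k == sg k])); last first.
        by apply/funext => z; apply: eq_forallb => k; rewrite inE.
      apply: measurable_forall_in => k; apply/fin_measurable_bool.
      apply: (fin_measurable_app (fun i => i == sg k)).
      apply: (@fin_measurable_selected R nu U g hG _ Y n m tie
        (fun z : Y => PP z.1.1 z.2) (fun (z : Y) j i => Z j i z.2)) => //.
        move=> i; rewrite /PP; case: eqP => // /eqP ii0; exact: mom (mP _ ii0).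
      move=> k' i k'm; apply: mom.
      exact: (mNs (inl (Ordinal k'm, i))).
    exact: measurable_indicator.
  apply: (@measurable_loo_weight R dX _ X Y n m x sg' th0 update _
    (fun z : Y => pts z.1.2 z.2)) => //.
    by move=> t y o th; exact: update_measurable.
  move=> k; rewrite /pts; case: eqP => // /eqP kj.
  apply: (measurable_add_noise hG).
    (* Injectivity of [sg] enters here: a round other than [j] releases a p-value other than that of
       [i0]. *)
    apply: mom (mP _ _); rewrite sg'E /i0.
    by apply: contra kj => /eqP /sg_inj ->.
  by apply: mom (mNs (inr k) _).
have Kf0 q b om : 0 <= Kf q b om by rewrite mulr_ge0 // loo_weight_ge0.
have Kf1 q b om : Kf q b om <= 1.
  by rewrite /Kf; case: [forall _, _]; rewrite ?mul1r ?mul0r ?loo_weight_le1.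
(* [q] enters only through the selection: the values in [pts] come from [b] and from other
   hypotheses. *)
have KfC q b om : Kf (1 - q) b om = Kf q b om.
  have selC : sel (1 - q) om = sel q om.
    apply/funext => k; apply: selected_mirrored.
    apply/funext => i; rewrite /mirrored /PP; case: (i == i0) => //.
    by rewrite subKr minC.
  by rewrite /Kf selC.
have mp0 : measurable_fun [set: T] (p i0 \o S : T -> measurableTypeR R).
  exact: (measurableT_comp (mp i0) mS).
have mw0 : measurable_fun [set: T] (W j : T -> measurableTypeR R) by exact: (mN k0).
pose p0 : {mfun T >-> measurableTypeR R} :=
  HB.pack (p i0 \o S : T -> measurableTypeR R) (isMeasurableFun.Build _ _ _ _ _ mp0).
pose w0 : {mfun T >-> measurableTypeR R} :=
  HB.pack (W j : T -> measurableTypeR R) (isMeasurableFun.Build _ _ _ _ _ mw0).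
have Gm : G `<=` measurable by exact: leave_out_measurable.
have GI : setI_closed G by exact: leave_out_setI.
have GT : G setT by exact: leave_out_setT.
have Gind A B E : measurable A -> measurable B -> G E ->
    P ((p0 @^-1` A `&` w0 @^-1` B) `&` E) =
    (P (p0 @^-1` A) * P (w0 @^-1` B) * P E)%E.
  move=> mA mB GE.
  exact: (leave_out_independent mp null_indep null_nonnull_indep noise_indep
    noise_data_indep jH0 mA mB GE).
have LE (e : R -> bool) om :
    ([forall k : 'I_m, idx om k == sg k] && e (pv om j))%:R *
      loo (idx om) J j (fold_at j (pv om)) =
    (e (add_noise nu U g (p0 om) (w0 om)))%:R *
      Kf (p0 om) (Num.min (add_noise nu U g (p0 om) (w0 om))
        (1 - add_noise nu U g (p0 om) (w0 om))) om.
  have selE : sel (p0 om) om = idx om.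
    have PPE : PP (p0 om) om = fun i => p i (S om).
      by apply/funext => i; rewrite /PP; case: (i =P i0) => [->|].
    by rewrite /sel PPE.
  rewrite /Kf selE; case: forallP => [eidx|_]; last first.
    by rewrite /= !mul0r mulr0.
  have pvE (k : 'I_m) : pv om k = add_noise nu U g (p (sg k) (S om)) (W k om).
    by rewrite /dp_pvalue /released -/(idx om k) (eqP (eidx k)).
  have pvj : pv om j = add_noise nu U g (p0 om) (w0 om) := pvE j.
  set b := Num.min _ _.
  have looE : loo (idx om) J j (fold_at j (pv om)) = loo sg' J j (pts b om).
    apply: loo_weight_congr => k; first by rewrite sg'E; exact: (eqP (eidx k)).
    rewrite /fold_at /pts; case: (_ == _ :> nat); first by rewrite pvj.
    by rewrite sg'E; exact: pvE.
  by rewrite looE pvj andTb mul1r.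
have LfE (e : R -> bool) : L e = (fun om =>
    ((e (add_noise nu U g (p0 om) (w0 om)))%:R *
      Kf (p0 om) (Num.min (add_noise nu U g (p0 om) (w0 om))
        (1 - add_noise nu U g (p0 om) (w0 om))) om)%:E).
  by apply/funext => om; rewrite /L LE.
rewrite (LfE (fun b => b <= 2^-1)) (LfE (fun b => 2^-1 < b)); split.
- exact: (measurable_mirror_low p0 w0 Gm hG mKf).
- exact: (measurable_mirror_high p0 w0 Gm hG mKf).
have p001 om : 0 <= p0 om <= 1 by exact: p01.
have p0m : mirror_conservative P (p0 : T -> R) by exact: null_mirror.
have w0n (B : set (measurableTypeR R)) : measurable B ->
    distribution P w0 B = normal_prob 0 s B by exact: W_normal.
exact: (expectation_mirror Gm GI GT Gind hG s0 p001 p0m w0n mKf Kf0 Kf1 KfC).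
Qed.

End selection_mirror.

(** * Summing over selections and bounding the false discovery rate *)

(** The integral of a nonnegative function is a supremum over simple functions below it, hence
    monotone. It is applied to the false discovery proportion, whose measurability is never
    established. *)
Lemma ge0_le_integral_nonmeasurable d (T : measurableType d) (R : realType)
    (mu : {measure set T -> \bar R}) (f1 f2 : T -> \bar R) :
  (forall y, 0 <= f1 y)%E -> (forall y, f1 y <= f2 y)%E ->
  (\int[mu]_y f1 y <= \int[mu]_y f2 y)%E.
Proof.
move=> f10 f12; rewrite !ge0_integralE //; last first.
  by move=> y _; apply: le_trans (f12 y).
rewrite !patch_setT; apply: ereal_sup_le => _ /= [h hf <-].
by exists h => // y; apply: le_trans (hf y) _.
Qed.

Lemma rejected_congr (R : realType) (X : Type) (n m : nat) (x : 'I_n -> X)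
    (idx : nat -> 'I_n) (pt : nat -> R) (s0 : X -> R)
    (update update' : nat -> @observation R X m -> (X -> R) -> X -> R) alpha :
  (forall t, threshold x idx pt s0 update t = threshold x idx pt s0 update' t) ->
  rejected x idx pt s0 update alpha = rejected x idx pt s0 update' alpha.
Proof. by move=> /funext e; rewrite /rejected /fdr_hat e. Qed.

Lemma sum_indicator (R : pzRingType) (V : finType) (v0 : V) (F : V -> R) :
  \sum_v (v0 == v)%:R * F v = F v0.
Proof.
rewrite (bigD1 v0) //= eqxx mul1r big1 ?addr0 // => v vv0.
by rewrite eq_sym (negbTE vv0) mul0r.
Qed.

Theorem theorem4
  (R : realType)
  (* the transformation G *)
  (nu : {measure set (measurableTypeR R) -> \bar R}) (U : \bar R) (g : R -> R)
  (hG : transformation nu U g)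
  (* probability space, dataset of N records *)
  (d dR dX : measure_display) (T : measurableType d) (P : probability T R)
  (Rec : measurableType dR) (N : nat) (S : {RV P >-> N.-tuple Rec})
  (* side information, p-values, true nulls *)
  (X : measurableType dX) (n : nat) (x : 'I_n -> X)
  (p : 'I_n -> {mfun N.-tuple Rec >-> R}) (H0 : {set 'I_n})
  (hp01 : forall i D, 0 <= p i D <= 1)
  (Delta : R) (hDelta : 0 < Delta)
  (hsens : forall i, sensitivity_at_most nu U g (p i) Delta)
  (hnull_indep : mutually_independent P H0 (fun i => sigma_of (p i \o S)))
  (hnull_nonnull_indep : independent P
     (sigma_family H0 (fun i => p i \o S))
     (sigma_family (~: H0)%SET (fun i => p i \o S)))
  (hmirror : forall i, i \in H0 -> mirror_conservative P (p i \o S))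
  (* Mirror Peeling *)
  (m : nat) (hmn : (m <= n)%N) (mu : R) (hmu : 0 < mu)
  (tie : {set 'I_n} -> 'I_n) (htie : tie_breaking tie)
  (Z : nat -> 'I_n -> {RV P >-> R}) (W : nat -> {RV P >-> R})
  (hnoise : peeling_noise S m Delta mu Z W)
  (* AdaPT *)
  (alpha : R) (halpha : 0 <= alpha)
  (s0 : X -> R) (hs0 : forall y, s0 y <= 2^-1)
  (update : nat -> @observation R X m -> (X -> R) -> X -> R)
  (hupdate : update_principles nu U g tie x (fun i => p i \o S)
     (fun j i => Z j i) (fun j => W j) s0 update) :
  ('E_P[fun om => fdp H0
      (dp_adapt nu U g tie x (fun i => p i \o S)
         (fun j i => Z j i) (fun j => W j) s0 update alpha om)]
   <= alpha%:E)%E.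
Proof.
pose pS i : T -> R := p i \o S.
pose Zf j i : T -> R := Z j i.
pose Wf j : T -> R := W j.
pose obs t := dp_observed nu U g tie x pS Zf Wf s0 update t.
pose thr t := dp_threshold nu U g tie x pS Zf Wf s0 update t.
pose idx := dp_index nu U g tie pS Zf.
pose pv := dp_pvalue nu U g tie pS Zf Wf.
(* Adaptedness is stated point by point, so a factor through the observation is chosen for each time
   and each [y]. *)
have /choice[phi phiP] (ty : nat * X) : exists f : @observation R X m -> R,
    measurable_fun setT f /\ forall om, f (obs ty.1 om) = thr ty.1.+1 om ty.2.
  have [f mf fE] := doob_dynkin (threshold_adapted hupdate ty.1 ty.2).
  by exists f.
(* Capped by the current threshold, the factorized update rule is monotone and
   measurable on all observations, not only on those that some outcome realizes. *)
pose upd t (o : @observation R X m) (s : X -> R) (y : X) : R :=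
  Num.min (s y) (phi (t, y) o).
have updE t om : threshold x (idx om) (pv om) s0 update t =
    threshold x (idx om) (pv om) s0 upd t.
  elim: t => // t IH; apply/funext => y; rewrite /= -IH /upd.
  rewrite -[observed _ _ _ _ _]/(obs t om) (phiP (t, y)).2 min_r //.
  exact: (threshold_nonincreasing hupdate).
have upd_le t o s y : upd t o s y <= s y by rewrite ge_min lexx.
have upd_meas dY (Y : measurableType dY) t y
    (o : Y -> @observation R X m) (th : Y -> X -> R) :
    measurable_fun setT o -> measurable_fun setT (th ^~ y) ->
    measurable_fun setT (fun v => upd t (o v) (th v) y).
  move=> mo mth; apply: measurable_minr => //.
  exact: (measurableT_comp (phiP (t, y)).1 mo).
have idx_inj om : injective (fun j : 'I_m => idx om j) by exact: selected_inj.
pose sd := release_sd m Delta mu.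
pose J om := [set j : 'I_m | idx om j \in H0]%SET.
pose loo om j := loo_weight x s0 upd alpha (idx om) (J om) j (fold_at j (pv om)).
pose Jsg (sg : {ffun 'I_m -> 'I_n}) := [set j : 'I_m | sg j \in H0]%SET.
(* For fixed [sg] the set of null rounds is deterministic. Assignments failing [C] may be dropped:
   the actual selection is injective, and only rounds that select a null are summed. *)
pose C j (sg : {ffun 'I_m -> 'I_n}) := injectiveb sg && (sg j \in H0).
pose L (e : R -> bool) j (sg : {ffun 'I_m -> 'I_n}) om : \bar R :=
  if C j sg then
    (([forall k : 'I_m, idx om k == sg k] && e (pv om j))%:R *
     loo_weight x s0 upd alpha (idx om) (Jsg sg) j (fold_at j (pv om)))%:E
  else 0%E.
have L0 e j sg om : (0 <= L e j sg om)%E.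
  by rewrite /L; case: ifP => // _; rewrite lee_fin mulr_ge0 // loo_weight_ge0.
have LP j sg : [/\ measurable_fun setT (L (fun b => b <= 2^-1) j sg),
    measurable_fun setT (L (fun b => 2^-1 < b) j sg) &
    (\int[P]_om L (fun b => b <= 2^-1)%R j sg om <=
     \int[P]_om L (fun b => 2^-1 < b)%R j sg om)%E].
  rewrite /L; case CE: (C j sg); last by split.
  move: CE => /andP[/injectiveP sg_inj sgH].
  (* The existence of the round [j] forces [m > 0], so the release noise is nondegenerate. *)
  have sd0 : sd != 0.
    rewrite gt_eqF // sqrtr_gt0 divr_gt0 ?exprn_gt0 // mulr_gt0 ?exprn_gt0 //.
    by rewrite mulr_gt0 // ltr0n (leq_trans _ (ltn_ord j)).
  apply: (@selection_mirror R nu U g hG _ _ _ T P _ S _ X n m x (fun i => p i : _ -> R)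
    H0 _ hp01 hnull_indep hnull_nonnull_indep hmirror tie Zf Wf _ sd sd0 _
    (noise_independent hnoise) (noise_data_independent hnoise) s0 upd alpha upd_meas
    sg (Jsg sg) j sg_inj sgH).
  - exact: measurable_funP.
  - by move=> i; exact: measurable_funP.
  - by case=> [[? ?]|?] /=; exact: measurable_funP.
  - by move=> k B mB; exact: (W_normal hnoise).
have sumL e om : (\sum_(j < m) \sum_sg L e j sg om =
    (\sum_(j in J om) (e (pv om j))%:R * loo om j)%:E)%E.
  pose idxf : {ffun 'I_m -> 'I_n} := [ffun k : 'I_m => idx om k].
  have idxfE (sg : {ffun 'I_m -> 'I_n}) : [forall k : 'I_m, idx om k == sg k] = (idxf == sg).
    apply/forallP/eqP => [h|<- k]; last by rewrite ffunE.
    by apply/ffunP => k; rewrite ffunE; exact/eqP.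
  rewrite -sumEFin [RHS]big_mkcond /=; apply: eq_bigr => j _.
  pose F (sg : {ffun 'I_m -> 'I_n}) : R := (C j sg && e (pv om j))%:R *
    loo_weight x s0 upd alpha (idx om) (Jsg sg) j (fold_at j (pv om)).
  (* Exactly one assignment, the actual selection [idxf], contributes. *)
  transitivity (\sum_sg ((idxf == sg)%:R * F sg)%:E)%E.
    apply: eq_bigr => sg _; rewrite /L /F idxfE; case: (C j sg) => /=.
      by case: (idxf == sg); rewrite ?mul1r ?mul0r.
    by rewrite mul0r mulr0.
  rewrite sumEFin sum_indicator /F /C.
  have -> : injectiveb idxf.
    by apply/injectiveP => k k'; rewrite !ffunE; exact: idx_inj.
  have -> : Jsg idxf = J om by apply/setP => k; rewrite !inE ffunE.
  by rewrite ffunE inE; case: ifP => _; rewrite ?mul0r.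
have sumL0 e om : (0 <= \sum_(j < m) \sum_sg L e j sg om)%E.
  by apply: sume_ge0 => j _; apply: sume_ge0 => sg _.
have intL (e : R -> bool) : (forall j sg, measurable_fun setT (L e j sg)) ->
    (\int[P]_om \sum_(j < m) \sum_sg L e j sg om =
     \sum_(j < m) \sum_sg \int[P]_om L e j sg om)%E /\
    measurable_fun setT (fun om => \sum_(j < m) \sum_sg L e j sg om)%E.
  move=> mL; split; last by apply: emeasurable_sum => j; exact: emeasurable_sum.
  rewrite ge0_integral_sum //; first by apply: eq_bigr => j _; rewrite ge0_integral_sum.
  - by move=> j; exact: emeasurable_sum.
  - by move=> j om _; apply: sume_ge0 => sg _.
rewrite unlock.
apply: (@le_trans _ _ (\int[P]_om (alpha%:E *
    \sum_(j < m) \sum_sg L (fun b => b <= 2^-1)%R j sg om))%E).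
  apply: ge0_le_integral_nonmeasurable => om.
    by rewrite lee_fin divr_ge0.
  rewrite sumL -EFinM lee_fin /dp_adapt (rejected_congr alpha (fun t => updE t om)).
  exact: fdp_le_loo_weight.
have [low_int low_meas] := intL _ (fun j sg => let: And3 h _ _ := LP j sg in h).
have [high_int high_meas] := intL _ (fun j sg => let: And3 _ h _ := LP j sg in h).
rewrite ge0_integralZl_EFin // low_int.
rewrite -[leRHS]mule1; apply: lee_wpmul2l; first by rewrite lee_fin.
apply: (@le_trans _ _ (\sum_(j < m) \sum_sg
    \int[P]_om L (fun b => 2^-1 < b)%R j sg om)%E).
  by apply: lee_sum => j _; apply: lee_sum => sg _; have [] := LP j sg.
rewrite -high_int; apply: (@le_trans _ _ (\int[P]_om (cst 1%E om))%E).
  apply: ge0_le_integral_nonmeasurable => // om.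
  by rewrite sumL lee_fin sum_loo_weight_le1.
by rewrite integral_cst // mul1e probability_le1.
Qed.
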